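(* Let $p$ be a prime number and let $F$ be a field of characteristic $p$. Suppose that every Albert $p$-form over $F$ has a non-trivial zero; that is, for all $\alpha,\beta\in F$ and $\gamma,\delta\in F^\times$ there exists $(x,y,z)\in F_{\alpha+\beta}\oplus F_\alpha\oplus F_\beta$ with $(x,y,z)\neq(0,0,0)$ and $N_{F_{\alpha+\beta}/F}(x)+\gamma N_{F_\alpha/F}(y)+\delta N_{F_\beta/F}(z)=0$. Then $H^4(F)=0$.
   Context: Let $F$ be a field of characteristic $p>0$. For $a\in F$, $F_a$ denotes the $F$-algebra $F[T]/(T^p-T-a)$. Put $\wp(F)=\{\lambda^p-\lambda:\lambda\in F\}$. If $a\notin\wp(F)$ then $F_a$ is a cyclic field extension of $F$ of degree $p$; otherwise $F_a\cong F\times\cdots\times F$ ($p$ factors). In both cases $N_{F_a/F}:F_a\to F$ is the norm map, sending an element to the determinant of the $F$-linear map of $F_a$ given by multiplication by that element. For $\alpha,\beta\in F$ and $\gamma,\delta\in F^\times$, the Albert $p$-form $A(\alpha,\beta,\gamma,\delta)$ is the map $F_{\alpha+\beta}\oplus F_\alpha\oplus F_\beta\to F$, $(x,y,z)\mapsto N_{F_{\alpha+\beta}/F}(x)+\gamma N_{F_\alpha/F}(y)+\delta N_{F_\beta/F}(z)$. The space $\Omega^1(F)$ of absolute differential $1$-forms is the $F$-vector space generated by symbols $da$, $a\in F$, subject to $d(a+b)=da+db$ and $d(ab)=a\,db+b\,da$. Put $\Omega^n(F)=\bigwedge^n\Omega^1(F)$ (exterior power over $F$) for $n\ge1$, $\Omega^0(F)=F$,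 and $\Omega^n(F)=0$ for $n<0$. The derivation $d$ extends to $d:\Omega^n(F)\to\Omega^{n+1}(F)$ by $d(a_0\,da_1\wedge\ldots\wedge da_n)=da_0\wedge da_1\wedge\ldots\wedge da_n$. There is a well-defined group homomorphism (Artin–Schreier map) $\wp:\Omega^n(F)\to\Omega^n(F)/d\Omega^{n-1}(F)$ given on logarithmic differentials by $b\frac{da_1}{a_1}\wedge\ldots\wedge\frac{da_n}{a_n}\mapsto(b^p-b)\frac{da_1}{a_1}\wedge\ldots\wedge\frac{da_n}{a_n}$ for $b\in F$, $a_i\in F^\times$. One defines $H^{n+1}(F)=\operatorname{coker}(\wp)$. *)

(* Defs.v *)
From HB Require Import structures.
From mathcomp Require Import all_boot all_order all_algebra all_field.
From mathcomp Require Import freeg boolp.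

Set Implicit Arguments.
Unset Strict Implicit.
Unset Printing Implicit Defensive.

Import GRing.Theory.
Local Open Scope ring_scope.
Local Open Scope quotient_scope.

Section LinearQuotient.
Context (R : nzRingType) (V : lmodType R).

Inductive spanned (S : V -> Prop) : V -> Prop :=
| spanned0 : spanned S 0
| spannedZD a x y : S x -> spanned S y -> spanned S (a *: x + y).

Definition span_of (S : V -> Prop) : {pred V} := fun x => `[< spanned S x >].

Lemma spannedD S x y : spanned S x -> spanned S y -> spanned S (x + y).
Proof.
move=> hx hy; elim: hx => [|a u v Su _ IH]; first by rewrite add0r.
by rewrite -addrA; apply: spannedZD.
Qed.

Lemma spannedZ S a x : spanned S x -> spanned S (a *: x).
Proof.
elim=> [|b u v Su _ IH]; first by rewrite scaler0; apply: spanned0.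
by rewrite scalerDr scalerA; apply: spannedZD.
Qed.

Lemma spanned_gen S x : S x -> spanned S x.
Proof.
move=> Sx; rewrite -[x]addr0 -[x in x + _]scale1r.
by apply: spannedZD => //; apply: spanned0.
Qed.

Lemma span_of_zmod_closed S : zmod_closed (span_of S).
Proof.
split=> [|x y /asboolP hx /asboolP hy]; apply/asboolP; first exact: spanned0.
by rewrite -scaleN1r; apply/spannedD/spannedZ.
Qed.
HB.instance Definition _ S :=
  GRing.isZmodClosed.Build V (span_of S) (span_of_zmod_closed S).

Definition lquot (S : V -> Prop) := Quotient.quot (span_of S : zmodClosed V).
HB.instance Definition _ S := GRing.Zmodule.on (lquot S).

Definition lproj S (x : V) : lquot S := \pi_(Quotient.quot (span_of S)) x.

Lemma lproj_is_zmod_morphism S : zmod_morphism (lproj S).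
Proof. by move=> x y; rewrite /lproj raddfB. Qed.
HB.instance Definition _ S :=
  GRing.isZmodMorphism.Build V (lquot S) (lproj S) (lproj_is_zmod_morphism S).

Lemma lproj_surj S (w : lquot S) : exists x, w = lproj S x.
Proof. by exists (repr w); rewrite /lproj reprK. Qed.

Lemma lproj_eq S x y : lproj S x = lproj S y <-> spanned S (x - y).
Proof.
split=> [/eqP|h]; rewrite /lproj.
  by rewrite -Quotient.idealrBE => /asboolP.
by apply/eqP; rewrite -Quotient.idealrBE; apply/asboolP.
Qed.

Lemma lproj_eq0 S x : lproj S x = 0 <-> spanned S x.
Proof. by rewrite -[0](raddf0 (lproj S)) lproj_eq subr0. Qed.

Definition lquot_scale S (a : R) (w : lquot S) : lquot S :=
  lproj S (a *: (repr (w : Quotient.quot (span_of S)) : V)).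

Lemma lquot_scaleE S a x : lquot_scale a (lproj S x) = lproj S (a *: x).
Proof.
rewrite /lquot_scale; apply/lproj_eq; rewrite -scalerBr; apply/spannedZ/lproj_eq.
by rewrite /lproj reprK.
Qed.

Fact lquot_scaleA S a b (w : lquot S) :
  lquot_scale a (lquot_scale b w) = lquot_scale (a * b) w.
Proof. by have [x ->] := lproj_surj w; rewrite !lquot_scaleE scalerA. Qed.

Fact lquot_scale1 S : left_id 1 (@lquot_scale S).
Proof. by move=> w; have [x ->] := lproj_surj w; rewrite lquot_scaleE scale1r. Qed.

Fact lquot_scaleDr S : right_distributive (@lquot_scale S) +%R.
Proof.
move=> a u v; have [x ->] := lproj_surj u; have [y ->] := lproj_surj v.
by rewrite -raddfD !lquot_scaleE scalerDr raddfD.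
Qed.

Fact lquot_scaleDl S (w : lquot S) : {morph (@lquot_scale S)^~ w : a b / a + b}.
Proof.
by move=> a b; have [x ->] := lproj_surj w; rewrite !lquot_scaleE scalerDl raddfD.
Qed.

HB.instance Definition _ S := GRing.Zmodule_isLmodule.Build R (lquot S)
  (@lquot_scaleA S) (@lquot_scale1 S) (@lquot_scaleDr S) (@lquot_scaleDl S).

Lemma lproj_is_scalable S : scalable (lproj S).
Proof. by move=> a x; rewrite -lquot_scaleE. Qed.
HB.instance Definition _ S :=
  GRing.isScalable.Build R V (lquot S) *:%R (lproj S) (@lproj_is_scalable S).

Context (M : lmodType R).

Definition lquot_lift S (f : V -> M) (w : lquot S) : M :=
  f (repr (w : Quotient.quot (span_of S))).

Lemma lquot_liftE S (f : {linear V -> M}) x :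
  (forall y, S y -> f y = 0) -> lquot_lift f (lproj S x) = f x.
Proof.
move=> fS; rewrite /lquot_lift; apply/eqP; rewrite -subr_eq0 -linearB; apply/eqP.
have: spanned S (repr (lproj S x : Quotient.quot (span_of S)) - x).
  by apply/lproj_eq; rewrite /lproj reprK.
elim=> [|a u v Su _ IH]; first exact: linear0.
by rewrite linearP IH fS // scaler0 addr0.
Qed.

End LinearQuotient.

Section FreeModule.
Context (R : nzRingType) (K : choiceType).
Implicit Types (u v : {freeg K / R}).

Lemma freegUZ a b (x : K) : a *: << b *g x >> = << a * b *g x >> :> {freeg K / R}.
Proof. by apply/eqP/freeg_eqP => y; rewrite coeffZ !coeffU mulrA. Qed.

Lemma freeg_ind (P : {freeg K / R} -> Prop) :
  P 0 -> (forall a x u, P u -> P (a *: << x >> + u)) -> forall u, P u.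
Proof.
move=> P0 PS u; rewrite -[u]freeg_sumE.
elim: (dom u) => [|x r IH]; first by rewrite big_nil.
by rewrite big_cons -[coeff x u]mulr1 -freegUZ; apply: PS.
Qed.

Context (M : lmodType R).
Implicit Types (f g : K -> M).

Lemma fglift_dom f u : fglift f u = \sum_(x <- dom u) coeff x u *: f x.
Proof.
pose h := GRing.isZmodMorphism.Build _ _ (fglift f) (lift_is_additive f).
pose F : {additive {freeg K / R} -> M} := HB.pack (fglift f) h.
rewrite -{1}[u]freeg_sumE -[fglift f]/(F : _ -> _) raddf_sum.
by apply: eq_bigr => x _; rewrite /= liftU.
Qed.

Lemma fglift_is_linear f : linear (fglift f).
Proof.
move=> a u v; pose h := GRing.isZmodMorphism.Build _ _ (fglift f) (lift_is_additive f).
pose F : {additive {freeg K / R} -> M} := HB.pack (fglift f) h.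
have FD w w' : fglift f (w + w') = fglift f w + fglift f w'.
  exact: (raddfD F).
rewrite FD; congr (_ + _); elim/freeg_ind: u => [|b x u IH].
  by rewrite scaler0 -[fglift f]/(F : _ -> _) raddf0 scaler0.
by rewrite scalerDr !FD IH scalerDr !freegUZ !liftU scalerA !mulr1.
Qed.
HB.instance Definition _ f :=
  GRing.isSemilinear.Build R {freeg K / R} M *:%R (fglift f)
    (GRing.semilinear_linear (fglift_is_linear f)).
End FreeModule.

Section FreeModuleCom.
Context (R : comNzRingType) (K : choiceType) (M : lmodType R).

Lemma fglift_fun (f g : K -> M) a b u :
  fglift (fun x => a *: f x + b *: g x) u = a *: fglift f u + b *: fglift g u.
Proof.
rewrite !fglift_dom !scaler_sumr -big_split; apply: eq_bigr => x _ /=.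
by rewrite scalerDr !scalerA mulrC [b * _]mulrC.
Qed.
End FreeModuleCom.

Section ExteriorPower.
Context (F : fieldType) (V : lmodType F).

(* The relators making a tuple of vectors multilinear and alternating. *)
Variant ext_rel (n : nat) : {freeg (n.-tuple V) / F} -> Prop :=
| ext_rel_linear (s1 s2 : seq V) (a : F) (x y : V) (t u v : n.-tuple V) :
    t = s1 ++ (a *: x + y) :: s2 :> seq V ->
    u = s1 ++ x :: s2 :> seq V -> v = s1 ++ y :: s2 :> seq V ->
    ext_rel (<< t >> - a *: << u >> - << v >>)
| ext_rel_alternate (t : n.-tuple V) : ~~ uniq t -> ext_rel << t >>.

Definition ext_power (n : nat) := lquot (@ext_rel n).
HB.instance Definition _ n := GRing.Lmodule.on (ext_power n).

Definition wedge n (t : n.-tuple V) : ext_power n := lproj (@ext_rel n) << t >>.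

(* The same on sequences, with the junk value 0 when the size is wrong. *)
Definition wedges n (s : seq V) : ext_power n := oapp (@wedge n) 0 (insub s).

Lemma wedgesE n (t : n.-tuple V) : wedges n t = wedge t.
Proof. by rewrite /wedges valK. Qed.

Definition multilinear (M : lmodType F) n (h : seq V -> M) :=
  forall s1 s2 a x y, size (s1 ++ x :: s2) = n ->
    h (s1 ++ (a *: x + y) :: s2) = a *: h (s1 ++ x :: s2) + h (s1 ++ y :: s2).

Definition alternating (M : lmodType F) n (h : seq V -> M) :=
  forall s, size s = n -> ~~ uniq s -> h s = 0.

Lemma size_mid (T : Type) (s1 s2 : seq T) x y :
  size (s1 ++ x :: s2) = size (s1 ++ y :: s2).
Proof. by rewrite !size_cat. Qed.

Lemma wedges_multilinear n : multilinear n (wedges n).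
Proof.
move=> s1 s2 a x y hs.
have hx : size (s1 ++ x :: s2) == n by apply/eqP.
have hy : size (s1 ++ y :: s2) == n by rewrite (size_mid _ _ _ x).
have hz : size (s1 ++ (a *: x + y) :: s2) == n by rewrite (size_mid _ _ _ x).
rewrite -[_ ++ x :: _]/(val (Tuple hx)) -[_ ++ y :: _]/(val (Tuple hy)).
rewrite -[_ ++ (_ + _) :: _]/(val (Tuple hz)) !wedgesE /wedge -linearZ -linearD.
apply/lproj_eq; rewrite opprD addrA; apply: spanned_gen.
exact: ext_rel_linear.
Qed.

Lemma wedges_alternating n : alternating n (wedges n).
Proof.
move=> s /eqP hs us; rewrite -[s]/(val (Tuple hs)) wedgesE.
by apply/lproj_eq0/spanned_gen/ext_rel_alternate.
Qed.

Lemma ext_power_ind n (P : ext_power n -> Prop) :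
  P 0 -> (forall a t u, P u -> P (a *: wedge t + u)) -> forall u, P u.
Proof.
move=> P0 PS u; have [x ->] := lproj_surj u.
elim/freeg_ind: x => [|a t x IH]; first by rewrite linear0.
by rewrite linearD linearZ; apply: PS.
Qed.

Section Lift.
Context (M : lmodType F) (n : nat).
Implicit Types h : seq V -> M.

Definition ext_lift h : ext_power n -> M :=
  lquot_lift (fglift (fun t : n.-tuple V => h t)).

Lemma ext_lift_rel h : multilinear n h -> alternating n h ->
  forall y, @ext_rel n y -> fglift (fun t : n.-tuple V => h t) y = 0.
Proof.
move=> hm ha _ [s1 s2 a x y t u v tE uE vE|t ut]; last first.
  by rewrite liftU ha ?scaler0 // size_tuple.
rewrite !linearB linearZ /= !liftU !scale1r tE uE vE hm.
  by rewrite addrAC addrK subrr.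
by rewrite -uE size_tuple.
Qed.

Lemma ext_lift_is_linear h : multilinear n h -> alternating n h ->
  linear (ext_lift h).
Proof.
move=> hm ha a u v; have [x ->] := lproj_surj u; have [y ->] := lproj_surj v.
rewrite -linearP /ext_lift !lquot_liftE ?linearP // => z; exact: ext_lift_rel.
Qed.

Lemma ext_lift_wedge h (t : n.-tuple V) : multilinear n h -> alternating n h ->
  ext_lift h (wedge t) = h t.
Proof.
move=> hm ha; rewrite /ext_lift lquot_liftE => [|y]; last exact: ext_lift_rel.
by rewrite /= liftU scale1r.
Qed.

Lemma ext_lift_fun h1 h2 a b u :
  ext_lift (fun s => a *: h1 s + b *: h2 s) u = a *: ext_lift h1 u + b *: ext_lift h2 u.
Proof. by rewrite /ext_lift /lquot_lift fglift_fun. Qed.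
End Lift.

Section Alternation.
Context (M : lmodType F) (n : nat) (h : seq V -> M).
Hypotheses (hm : multilinear n h) (ha : alternating n h).

Lemma multilinearD s1 s2 x y : size (s1 ++ x :: s2) = n ->
  h (s1 ++ (x + y) :: s2) = h (s1 ++ x :: s2) + h (s1 ++ y :: s2).
Proof. by move=> hs; rewrite -[x in x + _]scale1r hm // scale1r. Qed.

Lemma multilinear0 s1 s2 x : size (s1 ++ x :: s2) = n -> h (s1 ++ 0 :: s2) = 0.
Proof.
move=> hs; apply: (addrI (h (s1 ++ 0 :: s2))).
by rewrite addr0 -multilinearD ?addr0 // (size_mid _ _ _ x).
Qed.

Lemma multilinearZ s1 s2 a x : size (s1 ++ x :: s2) = n ->
  h (s1 ++ (a *: x) :: s2) = a *: h (s1 ++ x :: s2).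
Proof.
by move=> hs; rewrite -[a *: x]addr0 hm // (multilinear0 hs) addr0.
Qed.

Lemma alternate_repeat s1 s2 s3 x : size (s1 ++ x :: s2 ++ x :: s3) = n ->
  h (s1 ++ x :: s2 ++ x :: s3) = 0.
Proof.
move=> hs; apply: ha => //; apply/negP.
by rewrite cat_uniq /= mem_cat mem_head orbT !andbF.
Qed.

Lemma alternate_swap s1 s2 s3 x y : size (s1 ++ x :: s2 ++ y :: s3) = n ->
  h (s1 ++ x :: s2 ++ y :: s3) = - h (s1 ++ y :: s2 ++ x :: s3).
Proof.
have sz u v u' v' :
    size (s1 ++ u :: s2 ++ v :: s3) = size (s1 ++ u' :: s2 ++ v' :: s3).
  by rewrite !size_cat /= !size_cat.
move=> hs; have szn u v : size (s1 ++ u :: s2 ++ v :: s3) = n by rewrite (sz _ _ x y).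
have szn' u v : size ((s1 ++ u :: s2) ++ v :: s3) = n.
  by rewrite -catA; apply: szn.
have := alternate_repeat (szn (x + y) (x + y)).
rewrite multilinearD ?szn //.
have E u : h (s1 ++ u :: s2 ++ (x + y) :: s3) =
    h (s1 ++ u :: s2 ++ x :: s3) + h (s1 ++ u :: s2 ++ y :: s3).
  by have := @multilinearD (s1 ++ u :: s2) s3 x y (szn' _ _); rewrite -!catA.
rewrite !E !alternate_repeat ?szn // add0r addr0 => /eqP.
by rewrite addr_eq0 => /eqP.
Qed.

Lemma alternate_front s1 s2 x : size (s1 ++ x :: s2) = n ->
  h (s1 ++ x :: s2) = (-1) ^+ size s1 *: h (x :: s1 ++ s2).
Proof.
elim/last_ind: s1 s2 => [|s1 z IH] s2; first by rewrite expr0 scale1r.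
rewrite -cats1 -!catA /= => hs.
rewrite (alternate_swap (s2 := [::])) //= IH.
  by rewrite size_cat addn1 exprS mulN1r scaleNr.
by rewrite -hs !size_cat.
Qed.
End Alternation.

End ExteriorPower.

Section Differentials.
Context (F : fieldType).

Variant omega1_rel : {freeg F / F} -> Prop :=
| omega1_rel_add a b : omega1_rel (<< a + b >> - << a >> - << b >>)
| omega1_rel_mul a b : omega1_rel (<< a * b >> - a *: << b >> - b *: << a >>).

Definition Omega1 := lquot omega1_rel.
HB.instance Definition _ := GRing.Lmodule.on Omega1.

Definition D (a : F) : Omega1 := lproj omega1_rel << a >>.

Definition derivation (M : lmodType F) (f : F -> M) :=
  (forall a b, f (a + b) = f a + f b) /\
  (forall a b, f (a * b) = a *: f b + b *: f a).

Lemma D_derivation : derivation D.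
Proof.
split=> a b; rewrite /D -?linearZ -linearD; apply/lproj_eq; rewrite opprD addrA.
  exact/spanned_gen/omega1_rel_add.
exact/spanned_gen/omega1_rel_mul.
Qed.

Lemma Omega1_ind (P : Omega1 -> Prop) :
  P 0 -> (forall a x u, P u -> P (a *: D x + u)) -> forall u, P u.
Proof.
move=> P0 PS u; have [x ->] := lproj_surj u.
elim/freeg_ind: x => [|a t x IH]; first by rewrite linear0.
by rewrite linearD linearZ; apply: PS.
Qed.

Section DerLift.
Context (M : lmodType F).
Implicit Types f g : F -> M.

Definition der_lift f : Omega1 -> M := lquot_lift (fglift f).

Lemma der_lift_rel f : derivation f -> forall y, omega1_rel y -> fglift f y = 0.
Proof.
move=> [fD fM] _ [a b|a b]; rewrite !linearB /= ?linearZ /= !liftU !scale1r.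
  by rewrite fD addrAC addrK subrr.
by rewrite !scalerN fM addrAC addrK subrr.
Qed.

Lemma der_liftP f a u v : derivation f ->
  der_lift f (a *: u + v) = a *: der_lift f u + der_lift f v.
Proof.
move=> df; have [x ->] := lproj_surj u; have [y ->] := lproj_surj v.
by rewrite -linearP /der_lift !lquot_liftE ?linearP // => z; exact: der_lift_rel.
Qed.

Lemma der_lift_D f a : derivation f -> der_lift f (D a) = f a.
Proof.
move=> df; rewrite /der_lift lquot_liftE => [|y]; last exact: der_lift_rel.
by rewrite /= liftU scale1r.
Qed.

Lemma der_lift_fun f g a b u :
  der_lift (fun x => a *: f x + b *: g x) u = a *: der_lift f u + b *: der_lift g u.
Proof. by rewrite /der_lift /lquot_lift fglift_fun. Qed.

Lemma der_lift0 u : der_lift (fun=> 0) u = 0.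
Proof.
transitivity (der_lift (fun=> 0 *: 0 + 0 *: 0) u).
  by congr (der_lift _ u); apply: funext => x; rewrite !scale0r addr0.
by rewrite (der_lift_fun (fun=> 0) (fun=> 0)) !scale0r addr0.
Qed.

Lemma der0 f : derivation f -> f 0 = 0.
Proof. by case=> fD _; apply: (addrI (f 0)); rewrite -fD !addr0. Qed.

Lemma der1 f : derivation f -> f 1 = 0.
Proof.
by case=> _ fM; apply: (addrI (f 1)); rewrite addr0 -{3}[1]mulr1 fM !scale1r.
Qed.

Lemma derX f a n : derivation f -> f (a ^+ n) = (n%:R * a ^+ n.-1) *: f a.
Proof.
move=> df; elim: n => [|n IH]; first by rewrite expr0 mul0r scale0r der1.
rewrite exprS df.2 IH scalerA -scalerDl; congr (_ *: _) => /=.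
case: n {IH} => [|n]; first by rewrite mul0r mulr0 add0r mul1r.
by rewrite /= mulrCA -exprS [in RHS]mulrS mulrDl mul1r addrC.
Qed.
End DerLift.

(* Universal property of Omega^n: a map of n scalars that is a derivation in
   each variable and alternating factors through (a_1, .., a_n) |->
   da_1 /\ .. /\ da_n. *)
Section MultiDerivation.
Context (M : lmodType F).
Implicit Types g : seq F -> M.

Definition multider n g := forall s1 s2, (size (s1 ++ s2)).+1 = n ->
  derivation (fun a => g (s1 ++ a :: s2)).

Definition altder n g := forall s, size s = n -> ~~ uniq s -> g s = 0.

Fixpoint mder_lift g (s : seq Omega1) : M :=
  if s is w :: s' then mder_lift (fun t => der_lift (fun a => g (a :: t)) w) s'
  else g [::].

Lemma mder_lift_fun g1 g2 a b s :
  mder_lift (fun t => a *: g1 t + b *: g2 t) s =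
  a *: mder_lift g1 s + b *: mder_lift g2 s.
Proof.
elim: s g1 g2 => [|w s IH] g1 g2 //=; rewrite -IH; congr (mder_lift _ s).
by apply: funext => t; rewrite der_lift_fun.
Qed.

Lemma mder_lift0 s : mder_lift (fun=> 0) s = 0.
Proof.
elim: s => [|w s IH] //=; rewrite -[RHS]IH; congr (mder_lift _ s).
by apply: funext => t; rewrite der_lift0.
Qed.

Lemma eq_mder_lift g1 g2 s : (forall t, size t = size s -> g1 t = g2 t) ->
  mder_lift g1 s = mder_lift g2 s.
Proof.
elim: s g1 g2 => [|w s IH] g1 g2 e /=; first exact: e.
apply: IH => t ht; congr (der_lift _ w); apply: funext => a.
by apply: e; rewrite /= ht.
Qed.

Lemma multider_lift n g w : multider n.+1 g ->
  multider n (fun t => der_lift (fun a => g (a :: t)) w).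
Proof.
move=> gm s1 s2 hs; split=> a b.
  rewrite -[RHS]scale1r scalerDr -der_lift_fun.
  congr (der_lift _ w); apply: funext => c; rewrite !scale1r.
  by rewrite -[LHS]/(g ((c :: s1) ++ _ :: s2)) (gm (c :: s1) s2 _).1 //= hs.
rewrite -der_lift_fun; congr (der_lift _ w); apply: funext => c.
by rewrite -[LHS]/(g ((c :: s1) ++ _ :: s2)) (gm (c :: s1) s2 _).2 //= hs.
Qed.

Lemma altder_lift n g w : altder n.+1 g ->
  altder n (fun t => der_lift (fun a => g (a :: t)) w).
Proof.
move=> ga s hs us; rewrite -[RHS](der_lift0 M w); congr (der_lift _ w).
by apply: funext => a; apply: ga; rewrite /= ?hs // negb_and us orbT.
Qed.

Lemma mder_lift_multilinear n g : multider n g -> multilinear n (mder_lift g).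
Proof.
move=> gm s1 s2 a x y; elim: s1 n g gm => [|w s1 IH] n g gm /= hs.
  transitivity (a *: mder_lift g (x :: s2) + 1 *: mder_lift g (y :: s2)).
    rewrite /= -mder_lift_fun; apply: eq_mder_lift => t ht.
    by rewrite der_liftP ?scale1r //; apply: (gm [::]); rewrite /= ht.
  by rewrite scale1r.
case: n gm hs => // n gm [hs]; apply: IH hs; exact: multider_lift.
Qed.

Lemma mder_lift_map n g s : multider n g -> size s = n ->
  mder_lift g (map D s) = g s.
Proof.
elim: s n g => [|a s IH] [|n] g gm //= [hs].
rewrite (IH n) //; last exact: multider_lift.
by apply: der_lift_D; apply: (gm [::]); rewrite /= hs.
Qed.

Lemma mder_lift_vanish n g a s1 s2 : multider n g ->
  (forall t1 t2, (size (t1 ++ t2)).+1 = n -> g (t1 ++ a :: t2) = 0) ->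
  (size (s1 ++ s2)).+1 = n -> mder_lift g (s1 ++ D a :: s2) = 0.
Proof.
elim: s1 n g => [|w s1 IH] n g gm g0 /= hs.
  rewrite -[RHS](mder_lift0 s2); apply: eq_mder_lift => t ht.
  rewrite der_lift_D; first by apply: (g0 [::]); rewrite /= ht.
  by apply: (gm [::]); rewrite /= ht.
case: n gm g0 hs => // n gm g0 [hs].
apply: (IH n) => //; first exact: multider_lift.
move=> t1 t2 ht; rewrite -[RHS](der_lift0 M w); congr (der_lift _ w).
by apply: funext => b; rewrite -[LHS]/(g ((b :: t1) ++ _)) g0 //= ht.
Qed.

Lemma mder_lift_alternating n g : multider n g -> altder n g ->
  alternating n (mder_lift g).
Proof.
move=> gm ga s; elim: s n g gm ga => [|w s IH] n g gm ga hs //=.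
case: n gm ga hs => // n gm ga [hs].
rewrite negb_and negbK => /orP[ws|us]; last first.
  by apply: (IH n) => //; [exact: multider_lift | exact: altder_lift].
move: hs; case/splitPr: ws => s1 s2 {IH} hs.
rewrite -[LHS]/(mder_lift g (w :: s1 ++ w :: s2)).
pose B u v := mder_lift g (u :: s1 ++ v :: s2); rewrite -[LHS]/(B w w).
have gl := mder_lift_multilinear gm.
have szB u v : size (u :: s1 ++ v :: s2) = n.+1.
  by rewrite /= -hs !size_cat.
have Bl a u v z : B (a *: u + v) z = a *: B u z + B v z.
  by apply: (gl [::]); apply: szB.
have Br a u v z : B z (a *: u + v) = a *: B z u + B z v.
  by apply: (gl (z :: s1)); apply: szB.
have B0l z : B 0 z = 0.
  by have := Bl (-1) 0 0 z; rewrite scaler0 addr0 scaleN1r addNr.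
have B0r z : B z 0 = 0.
  by have := Br (-1) 0 0 z; rewrite scaler0 addr0 scaleN1r addNr.
have BDD a : B (D a) (D a) = 0.
  rewrite /B /=; apply: (@mder_lift_vanish n); first exact: multider_lift.
    move=> t1 t2 ht; rewrite der_lift_D; last by apply: (gm [::]); rewrite /= size_cat /= addnS -size_cat ht.
    apply: ga; first by rewrite /= -ht !size_cat addnS.
    by rewrite /= mem_cat mem_head orbT.
  by rewrite -hs !size_cat addnS.
have BDl a b z : B (D (a + b)) z = B (D a) z + B (D b) z.
  by rewrite D_derivation.1 -[D a]scale1r Bl !scale1r.
have BDr a b z : B z (D (a + b)) = B z (D a) + B z (D b).
  by rewrite D_derivation.1 -[D a]scale1r Br !scale1r.
have BS a b : B (D a) (D b) + B (D b) (D a) = 0.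
  by have := BDD (a + b); rewrite BDl !BDr !BDD add0r addr0.
have BSr a v : B (D a) v + B v (D a) = 0.
  elim/Omega1_ind: v => [|c b v IH]; first by rewrite B0l B0r addr0.
  by rewrite Bl Br addrACA IH -scalerDr BS scaler0 addr0.
elim/Omega1_ind: w {hs szB} => [|c a v IH]; first exact: B0l.
by rewrite Bl !Br BDD IH scaler0 add0r addr0 -scalerDr BSr scaler0.
Qed.
End MultiDerivation.

Definition Omega (n : nat) := ext_power Omega1 n.
HB.instance Definition _ n := GRing.Lmodule.on (Omega n).

(* a_1, .., a_n |-> da_1 /\ .. /\ da_n *)
Definition dwedge n (s : seq F) : Omega n := wedges n (map D s).

Lemma dwedge_multider n : multider n (@dwedge n).
Proof.
move=> s1 s2 hs; rewrite /dwedge.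
have sz x : size (map D s1 ++ x :: map D s2) = n.
  by rewrite -hs !size_cat /= !size_map addnS.
have wm := @wedges_multilinear _ Omega1 n.
split=> a b; rewrite !map_cat /=.
  by rewrite D_derivation.1 (multilinearD wm).
by rewrite D_derivation.2 wm // (multilinearZ wm).
Qed.

Lemma dwedge_altder n : altder n (@dwedge n).
Proof.
move=> s hs us; apply: wedges_alternating; rewrite ?size_map //.
by apply: contraNN us; apply: map_uniq.
Qed.

Definition omega_lift (M : lmodType F) n (g : seq F -> M) : Omega n -> M :=
  ext_lift (mder_lift g).

Lemma omega_lift_is_linear (M : lmodType F) n (g : seq F -> M) :
  multider n g -> altder n g -> linear (@omega_lift M n g).
Proof.
move=> gm ga; apply: ext_lift_is_linear; first exact: mder_lift_multilinear.
exact: mder_lift_alternating.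
Qed.

Lemma omega_lift_dwedge (M : lmodType F) n (g : seq F -> M) s :
  multider n g -> altder n g -> size s = n -> omega_lift g (dwedge n s) = g s.
Proof.
move=> gm ga hs; have hs' : size (map D s) == n by rewrite size_map hs.
rewrite /dwedge -[map D s]/(val (Tuple hs')) wedgesE /omega_lift ext_lift_wedge.
- by rewrite /= (mder_lift_map gm hs).
- exact: mder_lift_multilinear.
exact: mder_lift_alternating.
Qed.

(* Omega^n is spanned over F by the da_1 /\ .. /\ da_n. *)
Lemma Omega_ind n (P : Omega n -> Prop) :
  P 0 -> (forall a s u, size s = n -> P u -> P (a *: dwedge n s + u)) ->
  forall u, P u.
Proof.
move=> P0 PS.
suff H k (s : seq Omega1) (t : seq F) a u : size (map D t ++ s) = n -> size s = k ->
    P u -> P (a *: wedges n (map D t ++ s) + u).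
  apply: ext_power_ind => // a t u Pu; rewrite -wedgesE.
  by apply: (H n t [::]); rewrite ?size_tuple.
elim: k s t a u => [|k IH] [|w s] //= t a u hs.
  move=> _ Pu; rewrite cats0; apply: PS => //.
  by rewrite -hs cats0 size_map.
case=> hk Pu; move: hs; elim/Omega1_ind: w a u Pu => [|b x w IHw] a u Pu hs.
  rewrite (multilinear0 (@wedges_multilinear _ _ n) hs) scaler0 add0r.
  exact: Pu.
have hw : size (map D t ++ w :: s) = n by rewrite (size_mid _ _ _ (b *: D x + w)).
have hx : size (map D t ++ D x :: s) = n by rewrite (size_mid _ _ _ w).
rewrite (wedges_multilinear _ _ hx) scalerDr scalerA -addrA.
have -> : map D t ++ D x :: s = map D (rcons t x) ++ s.
  by rewrite map_rcons -cats1 -catA.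
apply: IH => //; first by rewrite map_rcons -cats1 -catA.
exact: IHw.
Qed.

(* Omega^0 is the zeroth exterior power, freely spanned by the empty wedge. *)
Lemma Omega0_bij : bijective (fun a : F => a *: dwedge 0 [::]).
Proof.
pose g : seq F -> F^o := fun=> 1.
have gm : multider 0 g by move=> s1 s2.
have ga : altder 0 g by case.
have lin := omega_lift_is_linear gm ga.
have lin0 : @omega_lift F^o 0 g 0 = 0.
  by have := lin (-1) 0 0; rewrite scaler0 addr0 scaleN1r addNr.
exists (@omega_lift F^o 0 g) => [a|w].
  by rewrite -[a *: _]addr0 lin lin0 addr0 omega_lift_dwedge // [LHS]mulr1.
elim/Omega_ind: w => [|a s w /size0nil -> IH]; first by rewrite lin0 scale0r.
by rewrite lin omega_lift_dwedge // scalerDl IH [a *: _ : F^o]mulr1.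
Qed.

End Differentials.

Section LeftWedge.
Context (F : fieldType) (V : lmodType F) (n : nat).

Definition lwedge (v : V) : ext_power V n -> ext_power V n.+1 :=
  ext_lift (fun s => wedges n.+1 (v :: s)).

Lemma lwedge_multilinear (v : V) : multilinear n (fun s => wedges n.+1 (v :: s)).
Proof.
by move=> s1 s2 a x y hs; apply: (@wedges_multilinear _ _ _ (v :: s1)); rewrite /= hs.
Qed.

Lemma lwedge_alternating (v : V) : alternating n (fun s => wedges n.+1 (v :: s)).
Proof.
move=> s hs us; apply: wedges_alternating; rewrite /= ?hs //.
by rewrite negb_and us orbT.
Qed.

Lemma lwedge_is_linear v : linear (lwedge v).
Proof.
apply: ext_lift_is_linear; first exact: lwedge_multilinear.
exact: lwedge_alternating.
Qed.
HB.instance Definition _ v :=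
  GRing.isSemilinear.Build F (ext_power V n) (ext_power V n.+1) *:%R (lwedge v)
    (GRing.semilinear_linear (lwedge_is_linear v)).

Lemma lwedgeE v s : size s = n -> lwedge v (wedges n s) = wedges n.+1 (v :: s).
Proof.
move=> /eqP hs; rewrite -[s]/(val (Tuple hs)) wedgesE /lwedge ext_lift_wedge //.
  exact: lwedge_multilinear.
exact: lwedge_alternating.
Qed.

Lemma lwedgeP a u v w : lwedge (a *: u + v) w = a *: lwedge u w + lwedge v w.
Proof.
elim/ext_power_ind: w => [|b t w IH]; first by rewrite !linear0 addr0.
rewrite !linearP /= IH -wedgesE !lwedgeE ?size_tuple //.
rewrite (@wedges_multilinear _ _ _ [::]) /= ?size_tuple //.
by rewrite !scalerDr !scalerA [b * a]mulrC addrACA.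
Qed.

Lemma lwedgeD u v w : lwedge (u + v) w = lwedge u w + lwedge v w.
Proof. by rewrite -[u]scale1r lwedgeP !scale1r. Qed.

Lemma lwedge0 w : lwedge 0 w = 0.
Proof. by apply: (addrI (lwedge 0 w)); rewrite -lwedgeD !addr0. Qed.

Lemma lwedgeZ a u w : lwedge (a *: u) w = a *: lwedge u w.
Proof. by rewrite -[a *: u]addr0 lwedgeP lwedge0 addr0. Qed.
End LeftWedge.

Section ExteriorDerivative.
Context (F : fieldType).

(* Omega^n x Omega^(n+1) with a . (w, e) = (a w, a e + da /\ w); d is the second
   component of the F-linear map into it with
   da_1 /\ .. /\ da_n |-> (da_1 /\ .. /\ da_n, 0). *)
Definition jet (n : nat) : Type := (Omega F n * Omega F n.+1)%type.
HB.instance Definition _ n := GRing.Zmodule.copy (jet n) (Omega F n * Omega F n.+1)%type.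

Definition jet_scale n (a : F) (j : jet n) : jet n :=
  (a *: j.1, a *: j.2 + lwedge (D a) j.1).

Fact jet_scaleA n a b (j : jet n) : jet_scale a (jet_scale b j) = jet_scale (a * b) j.
Proof.
case: j => w e; rewrite /jet_scale /= scalerA; congr (_, _).
rewrite (D_derivation F).2 lwedgeD !lwedgeZ linearZ /= scalerDr scalerA -!addrA.
by congr (_ + _); rewrite addrC.
Qed.

Fact jet_scale1 n : left_id 1 (@jet_scale n).
Proof.
by case=> w e; rewrite /jet_scale /= (der1 (D_derivation F)) lwedge0 !scale1r addr0.
Qed.

Fact jet_scaleDr n : right_distributive (@jet_scale n) +%R.
Proof.
move=> a [w e] [w' e']; rewrite /jet_scale /=; congr (_, _) => /=.
  by rewrite scalerDr.
by rewrite scalerDr linearD addrACA.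
Qed.

Fact jet_scaleDl n (j : jet n) : {morph (@jet_scale n)^~ j : a b / a + b}.
Proof.
move=> a b; case: j => w e; rewrite /jet_scale /=; congr (_, _) => /=.
  by rewrite scalerDl.
by rewrite scalerDl (D_derivation F).1 lwedgeD addrACA.
Qed.

HB.instance Definition _ n := GRing.Zmodule_isLmodule.Build F (jet n)
  (@jet_scaleA n) (@jet_scale1 n) (@jet_scaleDr n) (@jet_scaleDl n).

Definition jet_gen n (s : seq F) : jet n := (dwedge n s, 0).

Lemma jet_gen_multider n : multider n (@jet_gen n).
Proof.
move=> s1 s2 hs; split=> a b; rewrite /jet_gen.
  by rewrite (dwedge_multider hs).1; congr (_, _); rewrite /= addr0.
rewrite (dwedge_multider hs).2; congr (_, _) => /=.
have sz x : size (s1 ++ x :: s2) = n by rewrite size_cat addnS -size_cat.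
rewrite !scaler0 !add0r /dwedge !lwedgeE ?size_map //.
rewrite !map_cat /= (@alternate_swap _ _ _ n.+1 _ _ _ [::]) ?addNr //=.
- exact: wedges_multilinear.
- exact: wedges_alternating.
by rewrite -map_cons -map_cat size_map sz.
Qed.

Lemma jet_gen_altder n : altder n (@jet_gen n).
Proof. by move=> s hs us; rewrite /jet_gen dwedge_altder. Qed.

Definition d n (w : Omega F n) : Omega F n.+1 := (omega_lift (@jet_gen n) w).2.

Lemma omega_lift_jet1 n (w : Omega F n) : (omega_lift (@jet_gen n) w).1 = w.
Proof.
have lin := omega_lift_is_linear (@jet_gen_multider n) (@jet_gen_altder n).
elim/Omega_ind: w => [|a s w hs IH].
  by have := lin (-1) 0 0; rewrite scaler0 addr0 scaleN1r addNr => ->.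
rewrite lin /= IH omega_lift_dwedge //; first exact: jet_gen_multider.
exact: jet_gen_altder.
Qed.

(* d(a w + w') = a dw + da /\ w + dw' *)
Lemma dP n a (w w' : Omega F n) : d (a *: w + w') = a *: d w + lwedge (D a) w + d w'.
Proof.
have lin := omega_lift_is_linear (@jet_gen_multider n) (@jet_gen_altder n).
by rewrite /d lin /= omega_lift_jet1.
Qed.

Lemma d_is_zmod_morphism n : zmod_morphism (@d n).
Proof.
move=> w w'; rewrite -scaleN1r addrC dP.
have -> : D (-1) = 0 :> Omega1 F.
  have h := D_derivation F; apply: (addrI (D 1)).
  by rewrite -h.1 subrr (der0 h) (der1 h) addr0.
by rewrite lwedge0 addr0 scaleN1r addrC.
Qed.
HB.instance Definition _ n :=
  GRing.isZmodMorphism.Build (Omega F n) (Omega F n.+1) (@d n) (@d_is_zmod_morphism n).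

Lemma dZ n a (w : Omega F n) : d (a *: w) = a *: d w + lwedge (D a) w.
Proof. by rewrite -[a *: w]addr0 dP raddf0 addr0. Qed.

Lemma d_dwedge0 n s : size s = n -> d (dwedge n s) = 0 :> Omega F n.+1.
Proof.
move=> hs; rewrite /d omega_lift_dwedge //; first exact: jet_gen_multider.
exact: jet_gen_altder.
Qed.

(* d (a0 da1 /\ .. /\ dan) = da0 /\ da1 /\ .. /\ dan *)
Lemma d_dwedge n a s : size s = n -> d (a *: dwedge n s) = dwedge n.+1 (a :: s).
Proof.
by move=> hs; rewrite dZ d_dwedge0 // scaler0 add0r /dwedge lwedgeE ?size_map.
Qed.

(* The subgroup d Omega^(n-1) of Omega^n. *)
Definition exact_form n : {pred Omega F n} :=
  match n with
  | 0 => fun w => w == 0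
  | m.+1 => fun w => `[< exists e : Omega F m, w = d e >]
  end.

Lemma exact_form_zmod_closed n : zmod_closed (@exact_form n).
Proof.
case: n => [|n]; split; rewrite ?unfold_in /=.
- exact: eqxx.
- by move=> x y; rewrite !unfold_in /= => /eqP -> /eqP ->; rewrite subrr.
- by apply/asboolP; exists 0; rewrite raddf0.
move=> x y; rewrite !unfold_in /= => /asboolP[e ->] /asboolP[e' ->].
by apply/asboolP; exists (e - e'); rewrite raddfB.
Qed.
HB.instance Definition _ n :=
  GRing.isZmodClosed.Build (Omega F n) (@exact_form n) (@exact_form_zmod_closed n).

Definition Omega_mod_exact n := Quotient.quot (@exact_form n : zmodClosed (Omega F n)).
HB.instance Definition _ n := GRing.Zmodule.on (Omega_mod_exact n).

Definition mod_exact n (w : Omega F n) : Omega_mod_exact n :=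
  \pi_(Quotient.quot (@exact_form n : zmodClosed (Omega F n))) w.

Lemma mod_exact_is_zmod_morphism n : zmod_morphism (@mod_exact n).
Proof. by move=> x y; rewrite /mod_exact raddfB. Qed.
HB.instance Definition _ n := GRing.isZmodMorphism.Build
  (Omega F n) (Omega_mod_exact n) (@mod_exact n) (@mod_exact_is_zmod_morphism n).

Lemma mod_exact_surj n (x : Omega_mod_exact n) : exists w, x = mod_exact w.
Proof. by exists (repr x); rewrite /mod_exact reprK. Qed.

Lemma mod_exact_eq n (x y : Omega F n) :
  mod_exact x = mod_exact y <-> x - y \in @exact_form n.
Proof.
split=> [/eqP|h]; rewrite /mod_exact; first by rewrite -Quotient.idealrBE.
by apply/eqP; rewrite -Quotient.idealrBE.
Qed.

End ExteriorDerivative.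

Section ArtinSchreierMap.
Context (F : fieldType) (p : nat) (charFp : p \in [pchar F]).

Local Notation D := (@D F).
Let Dder : derivation D := D_derivation F.

Lemma D_sum (I : Type) (r : seq I) (P : pred I) (f : I -> F) :
  D (\sum_(i <- r | P i) f i) = \sum_(i <- r | P i) D (f i).
Proof. exact: (big_morph D Dder.1 (der0 Dder)). Qed.

Lemma D_nat n : D n%:R = 0.
Proof.
by elim: n => [|n IH]; rewrite ?(der0 Dder) // mulrSr Dder.1 IH (der1 Dder) addr0.
Qed.

Lemma D_natM n a : D (n%:R * a) = n%:R *: D a.
Proof. by rewrite Dder.2 D_nat scaler0 addr0. Qed.

Lemma D_expp a : D (a ^+ p) = 0.
Proof. by rewrite (derX _ _ Dder) (pcharf0 charFp) mul0r scale0r. Qed.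

(* ((x + y)^p - x^p - y^p) / p *)
Definition carry (x y : F) : F :=
  \sum_(i < p.-1) ('C(p, i.+1) %/ p)%:R * (x ^+ (p.-1 - i) * y ^+ i.+1).

Lemma D_carry x y :
  D (carry x y) = (x + y) ^+ p.-1 *: D (x + y) - x ^+ p.-1 *: D x - y ^+ p.-1 *: D y.
Proof.
have pr_p : prime p := pcharf_prime charFp.
have pE : p = p.-1.+1 by rewrite prednK ?prime_gt0.
rewrite /carry; set q := p.-1 in pE *.
have binE (i : 'I_q) : (('C(p, i.+1) %/ p) * p = 'C(p, i.+1))%N.
  by rewrite divnK //; apply: prime_dvd_bin; rewrite //= [X in (_ < X)%N]pE ltnS.
have c1 (i : 'I_q) : (('C(p, i.+1) %/ p) * i.+1 = 'C(q, i))%N.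
  apply/eqP; rewrite -(eqn_pmul2l (prime_gt0 pr_p)) mulnA [(p * _)%N]mulnC binE.
  by rewrite mul_bin_diag mulnC.
have c2 (i : 'I_q) : (('C(p, i.+1) %/ p) * (q - i) = 'C(q, i.+1))%N.
  apply/eqP; rewrite -(eqn_pmul2l (prime_gt0 pr_p)) mulnA [(p * _)%N]mulnC binE.
  by rewrite mul_bin_down mulnC {2}pE subSS.
transitivity (\sum_(i < q) ((x ^+ (q - i) * y ^+ i *+ 'C(q, i)) *: D y +
                  (x ^+ (q - i.+1) * y ^+ i.+1 *+ 'C(q, i.+1)) *: D x)).
  rewrite D_sum; apply: eq_bigr => i _.
  rewrite D_natM Dder.2 !(derX _ _ Dder) scalerDr !scalerA -c1 -c2.
  congr (_ *: _ + _ *: _).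
    by rewrite -[RHS]mulr_natl natrM /= !mulrA -!mulrA; congr (_ * _); rewrite mulrCA.
  rewrite -[RHS]mulr_natl natrM subnS -!mulrA; congr (_ * _).
  by rewrite mulrCA; congr (_ * _); rewrite mulrC.
rewrite big_split -!scaler_suml /= Dder.1 scalerDr.
have -> : \sum_(i < q) x ^+ (q - i) * y ^+ i *+ 'C(q, i) = (x + y) ^+ q - y ^+ q.
  by rewrite exprDn big_ord_recr /= subnn binn mul1r addrK.
have -> : \sum_(i < q) x ^+ (q - i.+1) * y ^+ i.+1 *+ 'C(q, i.+1)
    = (x + y) ^+ q - x ^+ q.
  by rewrite exprDn big_ord_recl /= subn0 bin0 mulr1 mulr1n addrAC subrr add0r.
rewrite !scalerBl addrACA -opprD [y ^+ q *: _ + _]addrC opprD addrA.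
by rewrite [_ *: D y + _ *: D x]addrC.
Qed.

(* Omega^n / d Omega^(n-1) with F acting through Frobenius: a . [w] = [a^p w]. *)
Definition frob_mod (charFp : p \in [pchar F]) (n : nat) : Type := Omega_mod_exact F n.
HB.instance Definition _ n := GRing.Zmodule.on (frob_mod charFp n).

Definition frob_scale n (a : F) (x : frob_mod charFp n) : frob_mod charFp n :=
  mod_exact (a ^+ p *: (repr (x : Omega_mod_exact F n) : Omega F n)).

Lemma exact_form_exppZ n a (w : Omega F n) :
  w \in @exact_form F n -> a ^+ p *: w \in @exact_form F n.
Proof.
case: n w => [|n] w; rewrite !unfold_in /=.
  by move=> /eqP ->; rewrite scaler0.
move=> /asboolP[e ->]; apply/asboolP; exists (a ^+ p *: e).
by rewrite dZ D_expp lwedge0 addr0.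
Qed.

Lemma frob_scaleE n a (w : Omega F n) :
  frob_scale a (mod_exact w : frob_mod charFp n) = mod_exact (a ^+ p *: w).
Proof.
apply/mod_exact_eq; rewrite -scalerBr; apply/exact_form_exppZ/mod_exact_eq.
by rewrite /mod_exact reprK.
Qed.

Fact frob_scaleA n a b (x : frob_mod charFp n) :
  frob_scale a (frob_scale b x) = frob_scale (a * b) x.
Proof.
by have [w ->] := mod_exact_surj x; rewrite !frob_scaleE scalerA exprMn.
Qed.

Fact frob_scale1 n : left_id 1 (@frob_scale n).
Proof.
by move=> x; have [w ->] := mod_exact_surj x; rewrite frob_scaleE expr1n scale1r.
Qed.

Fact frob_scaleDr n : right_distributive (@frob_scale n) +%R.
Proof.
move=> a x y; have [u ->] := mod_exact_surj x; have [v ->] := mod_exact_surj y.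
by rewrite -[_ + _ in LHS](raddfD (@mod_exact F n)) !frob_scaleE scalerDr raddfD.
Qed.

Fact frob_scaleDl n (x : frob_mod charFp n) :
  {morph (@frob_scale n)^~ x : a b / a + b}.
Proof.
move=> a b; have [w ->] := mod_exact_surj x; rewrite !frob_scaleE.
have -> : (a + b) ^+ p = a ^+ p + b ^+ p.
  by have := pFrobenius_autD_comm charFp (mulrC a b); rewrite !pFrobenius_autE.
by rewrite scalerDl raddfD.
Qed.

HB.instance Definition _ n := GRing.Zmodule_isLmodule.Build F (frob_mod charFp n)
  (@frob_scaleA n) (@frob_scale1 n) (@frob_scaleDr n) (@frob_scaleDl n).

Definition cartier_gen n (s : seq F) : frob_mod charFp n :=
  mod_exact ((\prod_(a <- s) a ^+ p.-1) *: dwedge n s).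

Lemma lwedge_prod_vanish n m (r s : seq F) : size s = n -> {subset r <= s} ->
  lwedge (D (\prod_(a <- r) a ^+ m)) (dwedge n s) = 0.
Proof.
move=> hs; elim: r => [|a r IH] rs; first by rewrite big_nil (der1 Dder) lwedge0.
rewrite big_cons Dder.2 lwedgeD !lwedgeZ IH; last first.
  by move=> b br; apply: rs; rewrite inE br orbT.
rewrite scaler0 add0r (derX _ _ Dder) lwedgeZ /dwedge lwedgeE ?size_map //.
rewrite wedges_alternating ?scaler0 //= ?size_map ?hs // negb_and negbK.
by rewrite map_f //; apply: rs; rewrite mem_head.
Qed.

Lemma cartier_gen_exact n s b : (size s).+1 = n ->
  (\prod_(a <- s) a ^+ p.-1) *: dwedge n (b :: s) \in @exact_form F n.
Proof.
case: n => // n [hs]; rewrite unfold_in; apply/asboolP.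
exists ((\prod_(a <- s) a ^+ p.-1 * b) *: dwedge n s).
rewrite dZ d_dwedge0 // scaler0 add0r Dder.2 lwedgeD !lwedgeZ lwedge_prod_vanish //.
by rewrite scaler0 addr0 /dwedge lwedgeE ?size_map.
Qed.

Lemma cartier_gen_multider n : multider n (@cartier_gen n).
Proof.
move=> s1 s2 hs; have sz x : size (map D s1 ++ x :: map D s2) = n.
  by rewrite -hs !size_cat /= !size_map addnS.
have wm := @wedges_multilinear _ (Omega1 F) n.
pose c := \prod_(a <- s1 ++ s2) a ^+ p.-1.
have cE x : cartier_gen n (s1 ++ x :: s2) =
    mod_exact (c *: wedges n (map D s1 ++ (x ^+ p.-1 *: D x) :: map D s2)).
  rewrite /cartier_gen /dwedge map_cat /= (multilinearZ wm) // scalerA.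
  by congr (mod_exact (_ *: _)); rewrite /c !big_cat big_cons /= mulrCA mulrC.
split=> a b; rewrite !cE.
  rewrite -raddfD; apply/mod_exact_eq.
  have -> : (a + b) ^+ p.-1 *: D (a + b) =
      (a ^+ p.-1 *: D a + b ^+ p.-1 *: D b) + D (carry a b).
    have eq3 (P A B : Omega1 F) : P = A + B + (P - A - B).
      by rewrite -[P - A - B]addrA -opprD [RHS]addrC subrK.
    by rewrite D_carry; apply: eq3.
  rewrite !(multilinearD wm) // !scalerDr addrAC subrr add0r.
  rewrite (alternate_front wm (@wedges_alternating _ _ _)) // scalerA mulrC -scalerA.
  rewrite -map_cat -map_cons -[wedges _ _]/(dwedge n _) -signr_odd.
  have := cartier_gen_exact (carry a b) hs; rewrite -/c => h.
  by case: odd; rewrite /= ?expr1 ?expr0 ?scaleN1r ?scale1r ?rpredN.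
have fE x w : x *: (mod_exact w : frob_mod charFp n) = mod_exact (x ^+ p *: w).
  exact: frob_scaleE.
have pE : p = p.-1.+1 by rewrite prednK // prime_gt0 // (pcharf_prime charFp).
have pred1 (x y : F) : (x * y) ^+ p.-1 * x = x ^+ p * y ^+ p.-1.
  by rewrite exprMn mulrAC -exprSr -pE.
rewrite !fE -raddfD Dder.2 scalerDr !scalerA pred1 [a * b]mulrC pred1.
rewrite (multilinearD wm) // -!(scalerA (_ ^+ p)) !(multilinearZ wm) //.
rewrite /= scalerDr; congr (mod_exact (_ + _)); by rewrite !scalerA [c * _]mulrC mulrAC.
Qed.

Lemma cartier_gen_altder n : altder n (@cartier_gen n).
Proof. by move=> s hs us; rewrite /cartier_gen dwedge_altder // scaler0 raddf0. Qed.

(* The inverse Cartier operator, a da_1 /\ .. /\ da_n |->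
   a^p a_1^(p-1) .. a_n^(p-1) da_1 /\ .. /\ da_n mod exact forms. *)
Definition inv_cartier n (w : Omega F n) : Omega_mod_exact F n :=
  omega_lift (@cartier_gen n) w.

Lemma inv_cartier_is_zmod_morphism n : zmod_morphism (@inv_cartier n).
Proof.
have lin := omega_lift_is_linear (@cartier_gen_multider n) (@cartier_gen_altder n).
move=> u v; rewrite /inv_cartier addrC -scaleN1r lin scaleN1r.
exact: addrC.
Qed.
HB.instance Definition _ n := GRing.isZmodMorphism.Build
  (Omega F n) (Omega_mod_exact F n) (@inv_cartier n) (@inv_cartier_is_zmod_morphism n).

Lemma inv_cartierE n a s : size s = n ->
  inv_cartier (a *: dwedge n s) =
  mod_exact ((a ^+ p * \prod_(b <- s) b ^+ p.-1) *: dwedge n s).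
Proof.
have gm := @cartier_gen_multider n; have ga := @cartier_gen_altder n.
have lin := omega_lift_is_linear gm ga.
have lin0 : @omega_lift F (frob_mod charFp n) n (@cartier_gen n) 0 = 0.
  by have := lin (-1) 0 0; rewrite scaler0 addr0 scaleN1r addNr.
move=> hs; rewrite /inv_cartier -[a *: _]addr0 lin lin0 addr0 omega_lift_dwedge //.
by rewrite -scalerA; exact: frob_scaleE.
Qed.

(* wp : Omega^n -> Omega^n / d Omega^(n-1) *)
Definition wp n (w : Omega F n) : Omega_mod_exact F n := inv_cartier w - mod_exact w.

Lemma wp_is_zmod_morphism n : zmod_morphism (@wp n).
Proof. by move=> u v; rewrite /wp !raddfB /= ?opprD ?opprK addrACA. Qed.
HB.instance Definition _ n := GRing.isZmodMorphism.Build
  (Omega F n) (Omega_mod_exact F n) (@wp n) (@wp_is_zmod_morphism n).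

(* b da_1/a_1 /\ .. /\ da_n/a_n *)
Definition dlog n (b : F) (s : seq F) : Omega F n :=
  (b * \prod_(a <- s) a^-1) *: dwedge n s.

Lemma wp_dlog n b s : size s = n -> 0 \notin s ->
  wp (dlog n b s) = mod_exact (dlog n (b ^+ p - b) s).
Proof.
move=> hs s0; rewrite /wp /dlog inv_cartierE // -raddfB -scalerBl mulrBl.
congr (mod_exact ((_ - _) *: _)); rewrite exprMn -mulrA; congr (_ * _).
rewrite -prodrXl -big_split /= big_seq [RHS]big_seq; apply: eq_bigr => a /(memPn s0) a0.
have pE : p = p.-1.+1 by rewrite prednK // prime_gt0 // (pcharf_prime charFp).
by rewrite {1}pE exprS -mulrA -exprMn mulVf // expr1n mulr1.
Qed.

Definition wp_image n : {pred Omega_mod_exact F n} :=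
  fun x => `[< exists w : Omega F n, x = wp w >].

Lemma wp_image_zmod_closed n : zmod_closed (@wp_image n).
Proof.
split; first by apply/asboolP; exists 0; rewrite raddf0.
by move=> _ _ /asboolP[u ->] /asboolP[v ->]; apply/asboolP; exists (u - v);
  rewrite wp_is_zmod_morphism.
Qed.
HB.instance Definition _ n := GRing.isZmodClosed.Build
  (Omega_mod_exact F n) (@wp_image n) (@wp_image_zmod_closed n).

(* H_succ n is H^(n+1)(F) = coker (wp : Omega^n -> Omega^n / d Omega^(n-1)). *)
Definition H_succ n := Quotient.quot (@wp_image n : zmodClosed (Omega_mod_exact F n)).
HB.instance Definition _ n := GRing.Zmodule.on (H_succ n).

End ArtinSchreierMap.

Section AlbertForm.
Context (F : fieldType) (p : nat).

Definition AS_poly (a : F) : {poly F} := 'X^p - 'X - a%:P.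

(* F_a = F[T]/(T^p - T - a); {poly %/ h} is the intended quotient since h is
   monic of positive degree, cf. mk_monic_AS. *)
Definition AS_alg (a : F) := {poly %/ AS_poly a}.
HB.instance Definition _ a := GRing.ComUnitAlgebra.on (AS_alg a).
HB.instance Definition _ a := Vector.on (AS_alg a).

Lemma mk_monic_AS a : (1 < p)%N -> mk_monic (AS_poly a) = AS_poly a.
Proof.
move=> p1; have sz : (size (- 'X - a%:P : {poly F})%R < size ('X^p : {poly F})%R)%N.
  by rewrite -opprD size_polyN size_XaddC size_polyXn ltnS.
rewrite /mk_monic /AS_poly -addrA size_polyDl // size_polyXn ltnS (ltnW p1) /=.
by rewrite monicE lead_coefDl // lead_coefXn eqxx.
Qed.

End AlbertForm.

Definition lfun_det (F : fieldType) (V : vectType F) (f : 'End(V)) : F :=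
  \det (passmx.mxof (vbasis {:V}) (vbasis {:V}) f).

Definition AS_norm (F : fieldType) (p : nat) (a : F) (x : AS_alg p a) : F :=
  lfun_det (amull x).

Definition albert_form {F : fieldType} {p : nat} (alpha beta gamma delta : F)
    (v : AS_alg p (alpha + beta) * AS_alg p alpha * AS_alg p beta) : F :=
  AS_norm v.1.1 + gamma * AS_norm v.1.2 + delta * AS_norm v.2.
Arguments albert_form {F p} alpha beta gamma delta v.

(* Main.v *)
Require Import Defs.
From HB Require Import structures.
From mathcomp Require Import all_boot all_order all_algebra all_field.
From mathcomp Require Import perm ring boolp.

Set Implicit Arguments.
Unset Strict Implicit.
Unset Printing Implicit Defensive.

Import GRing.Theory.
Local Open Scope ring_scope.
Local Open Scope quotient_scope.

(** Write [alpha, a) for the class of alpha dlog a in H^2(F).  Three rules govern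
    these symbols: [alpha, N) = 0 when N is a nonzero norm from F_alpha
    (norm_dlog_trivial), [a, a) = 0 because a dlog a = da is exact, and
    dlog u /\ dlog (1 - u) = 0.

    Fix theta in Omega^1 and suppose that theta is, modulo trivial classes, an
    integer multiple of some [alpha_i, a_i) for each of three parameters alpha_1,
    alpha_2 and alpha_3 = alpha_1 + alpha_2.  Then dlog N /\ theta is trivial for
    every nonzero norm N from any of the three algebras F_(alpha_i).  A zero of the
    Albert form of alpha_1, alpha_2, b, c with nonzero norms reads A = B + C, where B
    and C agree with b and c up to such norms and sign, and A is itself such a norm up
    to sign.  Hence dlog b /\ dlog c /\ theta equals dlog B /\ dlog C /\ theta, and
    dlog (B/A) /\ dlog (C/A) = 0 turns the latter into terms containing
    dlog A /\ theta, which are trivial (albert_symbol_trivial).  When one of the norms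
    vanishes the relation only becomes simpler, because a nonzero element of norm zero
    forces its parameter into wp(F) (AS_norm_eq0).

    So every symbol alpha dlog a /\ dlog b /\ dlog c is trivial as soon as
    theta = alpha dlog a admits three such parameters.  For odd p one takes
    alpha, alpha and 2 alpha, since 2 is invertible modulo p.  For p = 2 one shifts
    alpha by values of a times the norm form of F_alpha: [alpha, a) = [alpha + B, B)
    for B = a n with n a nonzero norm.  Every element of F is a sum of two values of
    that norm form, so B_1 and B_2 can be chosen with B_1 + B_2 = alpha, and then
    (alpha + B_1) + (alpha + B_2) = alpha.

    For the vanishing of [alpha, N(x)), let T be the Artin-Schreier generator and
    S = T + alpha = T^p.  Writing x as a polynomial in S gives dlog N(x) =
    Tr (x^-1 dx), where d acts on the coefficients only, S being a p-th power.  As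
    alpha = T^p - T, the form alpha dlog N(x) is the difference of Tr (T^p dlog x)
    and Tr (T dlog x); the trace commutes with the inverse Cartier operator modulo
    exact forms, so this difference is wp of Tr (T dlog x).  Everything is carried
    out with the matrix of multiplication by S, and the only fact needed about
    traces is tr (A^p) = (tr A)^p. *)

(** * Traces of p-th powers of matrices *)

Lemma det_exp (R : comNzRingType) n (A : 'M[R]_n) k : \det (A ^+ k) = \det A ^+ k.
Proof. by elim: k => [|k IH]; rewrite ?det1 // !exprS det_mulmx IH. Qed.

Lemma pchar_mx (R : comNzRingType) p n :
  p \in [pchar R] -> p \in [pchar 'M[R]_n.+1].
Proof.
move=> charRp; rewrite inE (pcharf_prime charRp) /= -(rmorph_nat (@scalar_mx _ _)).
by rewrite (pcharf0 charRp) raddf0.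
Qed.

Section TraceFrobenius.
Context (R : comNzRingType) (p : nat) (charRp : p \in [pchar R]).

Lemma poly_Frobenius (f : {poly R}) :
  f ^+ p = map_poly (pFrobenius_aut charRp) f \Po 'X^p.
Proof.
have charPp : p \in [pchar {poly R}] by rewrite pchar_poly.
elim/poly_ind: f => [|f c IH].
  by rewrite rmorph0 comp_poly0 expr0n gtn_eqF // prime_gt0 ?(pcharf_prime charRp).
rewrite -(pFrobenius_autE charPp) pFrobenius_autD_comm; last exact: mulrC.
rewrite !pFrobenius_autE exprMn IH !rmorphD !rmorphM /= map_polyX map_polyC.
by rewrite comp_polyX comp_polyC polyC_exp.
Qed.

(** Raising the characteristic polynomial det (t - A) to the p-th power gives
    det (t^p - A^p); compare the second highest coefficients. *)
Lemma mxtrace_Frobenius n (A : 'M[R]_n) : \tr (A ^+ p) = (\tr A) ^+ p.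
Proof.
have p_gt0 := prime_gt0 (pcharf_prime charRp).
case: n A => [|n] A.
  by rewrite /mxtrace !big_ord0 expr0n gtn_eqF.
have charMp : p \in [pchar 'M[{poly R}]_n.+1] by apply: pchar_mx; rewrite pchar_poly.
have: char_poly A ^+ p = char_poly (A ^+ p) \Po 'X^p.
  rewrite /char_poly -det_exp -(pFrobenius_autE charMp).
  rewrite pFrobenius_autB_comm; last exact: comm_scalar_mx.
  rewrite !pFrobenius_autE -det_map_mx /char_poly_mx; congr (\det _).
  rewrite map_mxB map_scalar_mx /= comp_polyX !rmorphXn /=; congr (_ - _).
  rewrite -!rmorphXn /=; apply/matrixP => i j; rewrite !mxE.
  by rewrite comp_polyC.
move=> /(congr1 (fun f : {poly R} => f`_(p * n))).
rewrite poly_Frobenius !coef_comp_poly_Xn // !dvdn_mulr // mulKn // coef_map /=.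
rewrite -[n]/(n.+1.-1) !char_poly_trace // pFrobenius_autN.
by move/oppr_inj.
Qed.

End TraceFrobenius.

(** * Artin-Schreier equations solved by matrices *)

Section ArtinSchreierRoot.
Context (F : fieldType) (p : nat) (charFp : p \in [pchar F]).

(** Taking traces in C^p = C + alpha gives m alpha = (tr C)^p - tr C, and m is
    fixed by the Frobenius map. *)
Lemma AS_root_of_matrix m (C : 'M[F]_m) (alpha : F) :
  m%:R != 0 :> F -> C ^+ p = C + alpha%:M -> exists b, alpha = b ^+ p - b.
Proof.
move=> m0 hC; exists (\tr C / m%:R).
have hm : (m%:R : F) ^+ p = m%:R by rewrite -(pFrobenius_autE charFp) pFrobenius_aut_nat.
have := congr1 (@mxtrace _ _) hC.
rewrite (mxtrace_Frobenius charFp) mxtraceD mxtrace_scalar expr_div_n hm => ->.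
by rewrite mulrDl addrC addKr -[alpha *+ m]mulr_natr mulfK.
Qed.

(** T acts on the kernel of Y, whose dimension lies strictly between 0 and p and is
    therefore invertible in F. *)
Lemma AS_root_of_singular n (T Y : 'M[F]_n) (alpha : F) :
  n = p -> T ^+ p = T + alpha%:M -> T *m Y = Y *m T -> Y != 0 -> \det Y = 0 ->
  exists b, alpha = b ^+ p - b.
Proof.
move=> np hT TY Y0 detY; set K := kermx Y; pose B := row_base K.
have rY : (0 < \rank Y < n)%N.
  rewrite lt0n mxrank_eq0 Y0 ltn_neqAle rank_leq_row andbT.
  apply/negP => Yfree; have : Y \in unitmx by rewrite -row_free_unit.
  by rewrite unitmxE detY unitr0.
have m0 : (\rank K)%:R != 0 :> F.
  rewrite -(dvdn_pcharf charFp) mxrank_ker -np; case/andP: rY => r0 rn.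
  by rewrite gtnNdvd ?subn_gt0 // ltn_subrL r0 (leq_ltn_trans _ rn).
have BTK : (B *m T <= B)%MS.
  have BY : B *m Y = 0 by apply/sub_kermxP; rewrite /B eq_row_base.
  apply: (@submx_trans _ _ _ _ _ _ K); last by rewrite /B eq_row_base.
  by apply/sub_kermxP; rewrite -mulmxA TY mulmxA BY mul0mx.
pose C := B *m T *m pinvmx B.
have CB : C *m B = B *m T by rewrite mulmxKpV.
have CXB k : C ^+ k *m B = B *m T ^+ k.
  elim: k => [|k IH]; first by rewrite !expr0 mul1mx mulmx1.
  by rewrite exprSr -mulmxA CB mulmxA IH -mulmxA [in RHS]exprSr.
apply: (AS_root_of_matrix m0 (C := C)).
apply: (row_free_inj (row_base_free K)).
by rewrite CXB hT mulmxDl mulmxDr CB mul_scalar_mx mul_mx_scalar.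
Qed.

End ArtinSchreierRoot.

(** * The norm of F_alpha as a determinant *)

Import passmx.

Section NormMatrix.
Context (F : fieldType) (q : nat) (charFp : q.+1 \in [pchar F]) (alpha : F).
Local Notation p := q.+1.
Local Notation L := (AS_alg p alpha).
Local Notation bL := (vbasis {:L}).

(** Multiplication by S = T + alpha = T^p on F_alpha in the basis 1, S, .., S^(p-1),
    read off from S^p = S + alpha^p.  Unlike the matrix of T, its entries are p-th
    powers, hence killed by every derivation of F. *)
Definition AS_matrix : 'M[F]_p :=
  \matrix_(i, j)
    if i == ord_max then (j == 0%N :> nat)%:R * alpha ^+ p + (j == 1%N :> nat)%:R
    else (j == i.+1 :> nat)%:R.

(** Evaluation of a polynomial at S. *)
Definition AS_eval (h : {poly F}) : L :=
  in_qpoly (AS_poly p alpha) (h \Po ('X + alpha%:P)).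

Let p_gt1 : (1 < p)%N := prime_gt1 (pcharf_prime charFp).

Lemma size_mk_monic_AS : size (mk_monic (AS_poly p alpha)) = p.+1.
Proof.
have sz : (size (- 'X - alpha%:P : {poly F})%R < size ('X^p : {poly F})%R)%N.
  by rewrite -opprD size_polyN size_XaddC size_polyXn ltnS.
by rewrite mk_monic_AS // /AS_poly -addrA size_polyDl ?sz // size_polyXn.
Qed.

Lemma AS_evalD g h : AS_eval (g + h) = AS_eval g + AS_eval h.
Proof. by rewrite /AS_eval comp_polyD; apply: in_qpolyD. Qed.

Lemma AS_evalZ c h : AS_eval (c *: h) = c *: AS_eval h.
Proof. by rewrite /AS_eval comp_polyZ; apply: in_qpolyZ. Qed.

Lemma AS_evalM g h : AS_eval (g * h) = AS_eval g * AS_eval h.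
Proof. by rewrite /AS_eval comp_polyM; apply: in_qpolyM. Qed.

Lemma AS_evalC c : AS_eval c%:P = c *: 1.
Proof.
rewrite -[in LHS]alg_polyC AS_evalZ /AS_eval -polyC1 comp_polyC polyC1.
by congr (_ *: _); apply: in_qpoly1.
Qed.

Lemma AS_eval0 : AS_eval 0 = 0.
Proof. by rewrite -polyC0 AS_evalC scale0r. Qed.

Lemma AS_eval_surj x : exists h, x = AS_eval h.
Proof.
exists ((x : {poly F}) \Po ('X - alpha%:P)).
rewrite /AS_eval -comp_polyA comp_polyB comp_polyX comp_polyC addrK comp_polyXr.
by apply/val_inj/esym/in_qpoly_small/size_mk_monic.
Qed.

Lemma AS_eval_eq0 (h : {poly F}) : (size h <= p)%N -> AS_eval h = 0 -> h = 0.
Proof.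
have sX : size ('X + alpha%:P) = 2 by rewrite size_XaddC.
move=> hs /(congr1 (fun x : L => x : {poly F})); rewrite /AS_eval in_qpoly_small /=.
  by move/eqP; rewrite (comp_poly2_eq0 _ sX) => /eqP.
by rewrite size_comp_poly2 // size_mk_monic_AS ltnS.
Qed.

Lemma AS_eval_root : AS_eval 'X^p = AS_eval ('X + (alpha ^+ p)%:P).
Proof.
have charPp : p \in [pchar {poly F}] by rewrite pchar_poly.
rewrite /AS_eval rmorphXn /= comp_polyD !comp_polyX comp_polyC.
rewrite -(pFrobenius_autE charPp) pFrobenius_autD_comm; last exact: mulrC.
rewrite !pFrobenius_autE -polyC_exp.
have -> : 'X^p + (alpha ^+ p)%:P = AS_poly p alpha + ('X + alpha%:P + (alpha ^+ p)%:P).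
  by rewrite /AS_poly; ring.
rewrite in_qpolyD; set z := in_qpoly _ (AS_poly _ _).
suff -> : z = 0 by rewrite add0r.
by apply: val_inj; rewrite /z /= mk_monic_AS // Pdiv.Ring.rmodpp //; apply: mulrC.
Qed.

Definition AS_mulmx (x : L) : 'M[F]_(\dim {:L}) := mxof bL bL (amull x).

Definition AS_basis_mx : 'M[F]_(p, \dim {:L}) := \matrix_i rVof bL (AS_eval 'X^i).

Let bLP : basis_of {:L} bL := vbasisP _.

Lemma rVof_mulmx x y : rVof bL y *m AS_mulmx x = rVof bL (x * y).
Proof. by rewrite -rVof_app // lfunE. Qed.

Lemma AS_mulmxM x y : AS_mulmx (x * y) = AS_mulmx x *m AS_mulmx y.
Proof.
by rewrite mulrC /AS_mulmx -(mxof_comp _ _ bLP) amullM.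
Qed.

Lemma AS_mulmxP c x y : AS_mulmx (c *: x + y) = c *: AS_mulmx x + AS_mulmx y.
Proof. by rewrite /AS_mulmx !linearP. Qed.

Lemma AS_mulmx1 : AS_mulmx 1 = 1%:M.
Proof. by rewrite /AS_mulmx amull1 mxof1 ?(basis_free bLP). Qed.

Lemma AS_mulmx_inj x : AS_mulmx x = 0 -> x = 0.
Proof.
move=> /eqP; rewrite mxof_eq0 // => /eqP h; apply: amull_inj.
by rewrite h linear0.
Qed.

Lemma AS_basis_mxX : AS_basis_mx *m AS_mulmx (AS_eval 'X) = AS_matrix *m AS_basis_mx.
Proof.
pose g (j : nat) := rVof bL (AS_eval 'X^j).
have sum_delta k : (k < p)%N -> \sum_(j < p) (j == k :> nat)%:R *: g j = g k.
  move=> kp; rewrite (bigD1 (Ordinal kp)) //= eqxx scale1r big1 ?addr0 // => j jk.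
  by rewrite -[(_ == _ :> nat)]/(j == Ordinal kp) (negPf jk) scale0r.
apply/row_matrixP => i; rewrite !row_mul rowK rVof_mulmx -AS_evalM -exprS.
rewrite mulmx_sum_row -/(g i.+1).
have [->|im] := eqVneq i ord_max; last first.
  rewrite -sum_delta; last by rewrite ltnS ltn_neqAle im -ltnS ltn_ord.
  by apply: eq_bigr => j _; rewrite !mxE (negPf im) rowK.
rewrite /g AS_eval_root addrC -[_%:P]mulr1 mul_polyC -[1]/('X^0) -['X]/('X^1).
rewrite AS_evalD AS_evalZ linearD linearZ /= -/(g 0%N) -/(g 1%N).
rewrite -(sum_delta 0%N) // -(sum_delta 1%N) // scaler_sumr -big_split /=.
by apply: eq_bigr => j _; rewrite !mxE eqxx rowK scalerDl scalerA mulrC.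
Qed.

(** The two bases of F_alpha, the powers of S and the one underlying AS_norm, are
    intertwined by AS_basis_mx. *)
Lemma AS_basis_mx_horner h :
  AS_basis_mx *m AS_mulmx (AS_eval h) = horner_mx AS_matrix h *m AS_basis_mx.
Proof.
elim/poly_ind: h => [|h c IH].
  by rewrite rmorph0 mul0mx AS_eval0 /AS_mulmx !linear0.
rewrite addrC rmorphD rmorphM /= horner_mx_C horner_mx_X AS_evalD AS_evalM AS_evalC.
rewrite AS_mulmxP AS_mulmx1 AS_mulmxM mulmxDr mulmxA IH mulmxDl -!mulmxA AS_basis_mxX.
by rewrite -scalemxAr mulmx1 mul_scalar_mx.
Qed.

Lemma dim_AS_alg : \dim {:L} = p.
Proof. by rewrite [LHS]dim_polyn size_mk_monic_AS. Qed.

Lemma AS_basis_mx_free : row_free AS_basis_mx.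
Proof.
apply: inj_row_free => v vQ0; rewrite -[v]rVpolyK.
suff -> : rVpoly v = 0 by rewrite linear0.
apply: AS_eval_eq0; first exact: size_poly.
apply/eqP; rewrite -(rVof_eq0 bLP) -vQ0; apply/eqP.
rewrite mulmx_sum_row /rVpoly poly_def.
rewrite (big_morph AS_eval AS_evalD AS_eval0) linear_sum /=.
by apply: eq_bigr => i _; rewrite rowK AS_evalZ linearZ valK.
Qed.

Lemma AS_normE h : AS_norm (AS_eval h) = \det (horner_mx AS_matrix h).
Proof.
have := AS_basis_mx_horner h; rewrite /AS_norm /lfun_det -/(AS_mulmx _).
move: AS_basis_mx AS_basis_mx_free (AS_mulmx _) => Q.
move: dim_AS_alg Q; move: (\dim _) => n -> {n} Q.
rewrite row_free_unit => Qu M QM; have := congr1 determinant QM.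
rewrite !det_mulmx mulrC; apply: mulIf.
by rewrite -unitfE -unitmxE.
Qed.

Lemma AS_matrixX : AS_matrix ^+ p = AS_matrix + (alpha ^+ p)%:M.
Proof.
apply: (row_free_inj AS_basis_mx_free); rewrite -[in LHS](horner_mx_X AS_matrix).
rewrite -rmorphXn /= -AS_basis_mx_horner AS_eval_root AS_basis_mx_horner.
by rewrite rmorphD /= horner_mx_X horner_mx_C.
Qed.

Lemma AS_eval_neq0 h : AS_eval h != 0 -> horner_mx AS_matrix h != 0.
Proof.
apply: contraNneq => H0; apply/eqP/AS_mulmx_inj.
have := AS_basis_mx_horner h; rewrite H0 mul0mx.
move: AS_basis_mx AS_basis_mx_free (AS_mulmx _) => Q.
move: dim_AS_alg Q; move: (\dim _) => n -> {n} Q.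
by rewrite row_free_unit => Qu M QM; rewrite -(mulKmx Qu M) QM mulmx0.
Qed.

Lemma AS_matrix_Frobenius i j : exists c, AS_matrix i j = c ^+ p.
Proof.
have FrN n : (n%:R : F) = n%:R ^+ p.
  by rewrite -(pFrobenius_autE charFp) pFrobenius_aut_nat.
rewrite mxE; case: eqP => _; last by eexists; apply: FrN.
exists ((j == 0%N :> nat)%:R * alpha + (j == 1%N :> nat)%:R).
by rewrite -[RHS](pFrobenius_autE charFp) rmorphD rmorphM !rmorph_nat.
Qed.

(** The matrices of T and x commute, and the first solves C^p = C + alpha. *)
Lemma AS_norm_eq0 (x : L) : x != 0 -> AS_norm x = 0 -> exists b, alpha = b ^+ p - b.
Proof.
have [h ->] := AS_eval_surj x; rewrite AS_normE => /AS_eval_neq0.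
set Y := horner_mx _ _ => Y0 detY; pose T := AS_matrix - alpha%:M.
have charMp : p \in [pchar 'M[F]_p] by apply: pchar_mx.
have XY : AS_matrix *m Y = Y *m AS_matrix.
  by rewrite -(horner_mx_X AS_matrix); apply: comm_horner_mx2.
apply: (AS_root_of_singular charFp (T := T) (Y := Y)) => //.
  rewrite /T -(pFrobenius_autE charMp) pFrobenius_autB_comm; last exact: comm_mx_scalar.
  by rewrite !pFrobenius_autE AS_matrixX -rmorphXn /= addrK subrK.
by rewrite mulmxBl mulmxBr XY mul_scalar_mx mul_mx_scalar.
Qed.

End NormMatrix.

(** * Frobenius additivity of logarithmic derivatives *)

Section Carry.
Context (R : comNzRingType) (M : zmodType) (p : nat) (pr_p : prime p).
(* E g x stands for g dx, in the image of the differentials under an additive map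
   that need not be linear over R, such as a trace. *)
Context (E : R -> R -> M).
Context (EDl : forall g h x, E (g + h) x = E g x + E h x).
Context (EDr : forall g x y, E g (x + y) = E g x + E g y).
Context (EM : forall g x y, E g (x * y) = E (g * y) x + E (g * x) y).

(** ((x + y)^p - x^p - y^p) / p *)
Definition carry_sum (x y : R) : R :=
  \sum_(i < p.-1) x ^+ (p.-1 - i) * y ^+ i.+1 *+ ('C(p, i.+1) %/ p).

Lemma leibniz0l x : E 0 x = 0.
Proof. by apply: (addrI (E 0 x)); rewrite -EDl !addr0. Qed.

Lemma leibniz0r g : E g 0 = 0.
Proof. by apply: (addrI (E g 0)); rewrite -EDr !addr0. Qed.

Lemma leibnizBl g h x : E (g - h) x = E g x - E h x.
Proof. by apply/eqP; rewrite eq_sym subr_eq -EDl subrK. Qed.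

Lemma leibnizMnl g x n : E (g *+ n) x = E g x *+ n.
Proof. by elim: n => [|n IH]; rewrite ?leibniz0l // !mulrS EDl IH. Qed.

Lemma leibnizMnr g x n : E g (x *+ n) = E g x *+ n.
Proof. by elim: n => [|n IH]; rewrite ?leibniz0r // !mulrS EDr IH. Qed.

Lemma leibniz_exp g x n : E g (x ^+ n) = E (g * x ^+ n.-1) x *+ n.
Proof.
elim: n g => [|n IH] g.
  apply: (addrI (E g 1)); rewrite expr0 mulr0n addr0.
  by rewrite -[in RHS](mulr1 1) EM mulr1.
rewrite exprS EM IH -mulrA -exprS mulrS; case: n {IH} => [|n] //=.
Qed.

(** This is the derivative of p carry_sum = (x + y)^p - x^p - y^p, divided by p. *)
Lemma leibniz_carry g x y :
  E g (carry_sum x y) = E (g * (x + y) ^+ p.-1) (x + y)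
    - E (g * x ^+ p.-1) x - E (g * y ^+ p.-1) y.
Proof.
have pE : p = p.-1.+1 by rewrite prednK ?prime_gt0.
rewrite /carry_sum; set q := p.-1 in pE *.
have binE (i : 'I_q) : (('C(p, i.+1) %/ p) * p = 'C(p, i.+1))%N.
  by rewrite divnK //; apply: prime_dvd_bin; rewrite //= [X in (_ < X)%N]pE ltnS.
have binl (i : 'I_q) : (i.+1 * ('C(p, i.+1) %/ p) = 'C(q, i))%N.
  apply/eqP; rewrite -(eqn_pmul2l (prime_gt0 pr_p)) mulnCA [(p * _)%N]mulnC binE.
  by rewrite mul_bin_diag.
have binr (i : 'I_q) : ((q - i) * ('C(p, i.+1) %/ p) = 'C(q, i.+1))%N.
  apply/eqP; rewrite -(eqn_pmul2l (prime_gt0 pr_p)) mulnCA [(p * _)%N]mulnC binE.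
  by rewrite mul_bin_down {2}pE subSS.
pose u i := x ^+ (q - i) * y ^+ i *+ 'C(q, i).
transitivity (\sum_(i < q) (E (g * u i.+1) x + E (g * u i) y)).
  rewrite (big_morph (E g) (EDr g) (leibniz0r g)); apply: eq_bigr => i _.
  rewrite leibnizMnr EM !leibniz_exp mulrnDl -!mulrnA binl binr /u.
  by rewrite !mulrnAr !leibnizMnl -!mulrA subnS /= [y ^+ _ * x ^+ _]mulrC.
have sumE (I : finType) f z : E (g * \sum_(i : I) f i) z = \sum_(i : I) E (g * f i) z.
  by rewrite mulr_sumr (big_morph (E^~ z) (fun g h => EDl g h z) (leibniz0l z)).
rewrite big_split /= -!sumE EDr.
have -> : \sum_(i < q) u i = (x + y) ^+ q - y ^+ q.
  by rewrite exprDn big_ord_recr /= subnn binn mul1r addrK.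
have -> : \sum_(i < q) u i.+1 = (x + y) ^+ q - x ^+ q.
  by rewrite exprDn big_ord_recl /= subn0 bin0 mulr1 mulr1n addrAC subrr add0r.
by rewrite !mulrBr !leibnizBl addrACA addrA.
Qed.

End Carry.

(** * Derivations, traces and determinants *)

Section DerivationTrace.
Context (F : fieldType) (M : lmodType F) (f : F -> M) (derf : derivation f).

Lemma der_sum (I : Type) (r : seq I) (P : pred I) (c : I -> F) :
  f (\sum_(i <- r | P i) c i) = \sum_(i <- r | P i) f (c i).
Proof. exact: (big_morph f derf.1 (der0 derf)). Qed.

Lemma derN a : f (- a) = - f a.
Proof. by apply/eqP; rewrite -addr_eq0 -derf.1 addNr (der0 derf). Qed.

Lemma der_prod (I : finType) (c : I -> F) :
  f (\prod_i c i) = \sum_i (\prod_(j | i != j) c j) *: f (c i).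
Proof.
suff H (r : seq I) : uniq r -> f (\prod_(i <- r) c i) =
    \sum_(i <- r) (\prod_(j <- r | i != j) c j) *: f (c i).
  rewrite H ?index_enum_uniq //.
elim: r => [|i r IH] /=; first by rewrite !big_nil (der1 derf).
case/andP=> ir ur; rewrite !big_cons eqxx derf.2 IH // addrC scaler_sumr.
congr (_ *: _ + _).
  rewrite big_seq [RHS]big_seq_cond; apply: eq_bigl => j.
  by case jr: (j \in r) => //=; apply/esym; apply: contraNneq ir => ->.
rewrite big_seq [RHS]big_seq; apply: eq_bigr => j jr.
rewrite big_cons scalerA; case: (eqVneq j i) => [ji|//].
by rewrite -ji jr in ir.
Qed.

(** tr (Z dW), with the derivation f applied to W entrywise. *)
Definition der_tr n (Z W : 'M[F]_n) : M := \sum_i \sum_j Z i j *: f (W j i).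

Lemma der_trDl n (Z Z' W : 'M_n) : der_tr (Z + Z') W = der_tr Z W + der_tr Z' W.
Proof.
rewrite /der_tr -big_split; apply: eq_bigr => i _; rewrite -big_split.
by apply: eq_bigr => j _; rewrite mxE scalerDl.
Qed.

Lemma der_trZl n a (Z W : 'M_n) : der_tr (a *: Z) W = a *: der_tr Z W.
Proof.
rewrite /der_tr scaler_sumr; apply: eq_bigr => i _; rewrite scaler_sumr.
by apply: eq_bigr => j _; rewrite mxE scalerA.
Qed.

Lemma der_trDr n (Z W W' : 'M_n) : der_tr Z (W + W') = der_tr Z W + der_tr Z W'.
Proof.
rewrite /der_tr -big_split; apply: eq_bigr => i _; rewrite -big_split.
by apply: eq_bigr => j _; rewrite mxE derf.1 scalerDr.
Qed.

Lemma der_trM n (Z U V : 'M_n) :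
  der_tr Z (U *m V) = der_tr (V *m Z) U + der_tr (Z *m U) V.
Proof.
have -> : der_tr Z (U *m V) =
    \sum_i \sum_j \sum_k ((Z i j * U j k) *: f (V k i) + (V k i * Z i j) *: f (U j k)).
  apply: eq_bigr => i _; apply: eq_bigr => j _; rewrite mxE der_sum scaler_sumr.
  by apply: eq_bigr => k _; rewrite derf.2 scalerDr !scalerA [V _ _ * _]mulrC.
pose S (a : 'I_n -> 'I_n -> 'I_n -> M) := \sum_i \sum_j \sum_k a i j k.
transitivity (S (fun i j k => (Z i j * U j k) *: f (V k i)) +
    S (fun i j k => (V k i * Z i j) *: f (U j k))).
  rewrite -big_split; apply: eq_bigr => i _ /=; rewrite -big_split.
  by apply: eq_bigr => j _ /=; rewrite -big_split.
rewrite addrC; congr (_ + _); rewrite /S /der_tr; last first.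
  apply: eq_bigr => i _; rewrite exchange_big; apply: eq_bigr => k _.
  by rewrite mxE scaler_suml.
rewrite exchange_big; under eq_bigr do rewrite exchange_big.
rewrite exchange_big; apply: eq_bigr => k _; apply: eq_bigr => j _.
by rewrite mxE scaler_suml.
Qed.

(** Jacobi's formula. *)
Lemma der_det n (A : 'M_n) : f (\det A) = der_tr (\adj A) A.
Proof.
have f_sign (s : bool) a : f ((-1) ^+ s * a) = (-1) ^+ s *: f a.
  by case: s; rewrite ?expr1 ?expr0 ?mul1r ?scale1r // mulN1r scaleN1r derN.
rewrite /determinant der_sum /der_tr exchange_big /=.
transitivity (\sum_(s : 'S_n) \sum_i
    ((-1) ^+ s * \prod_(j | i != j) A j (s j)) *: f (A i (s i))).
  apply: eq_bigr => s _; rewrite f_sign der_prod scaler_sumr.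
  by apply: eq_bigr => i _; rewrite scalerA.
rewrite exchange_big; apply: eq_bigr => i _.
rewrite (partition_big (fun s : 'S_n => s i) predT) //=; apply: eq_bigr => j _.
rewrite mxE expand_cofactor scaler_suml.
by apply: eq_bigr => s /eqP ->.
Qed.

Definition der_const n (Z : 'M[F]_n) := forall i j, f (Z i j) = 0.

Lemma der_const_scalar n c : f c = 0 -> @der_const n c%:M.
Proof.
by move=> fc i j; rewrite mxE; case: eqP; rewrite ?mulr1n // mulr0n (der0 derf).
Qed.

Lemma der_constM n (U V : 'M_n) : der_const U -> der_const V -> der_const (U *m V).
Proof.
move=> hU hV i j; rewrite mxE der_sum big1 // => k _.
by rewrite derf.2 hU hV !scaler0 addr0.
Qed.

Lemma der_constX n (U : 'M_n) k : der_const U -> der_const (U ^+ k).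
Proof.
move=> hU; elim: k => [|k IH]; first by apply: der_const_scalar; rewrite (der1 derf).
by rewrite exprS; apply: der_constM.
Qed.

Lemma der_constD n (U V : 'M_n) : der_const U -> der_const V -> der_const (U + V).
Proof. by move=> hU hV i j; rewrite mxE derf.1 hU hV addr0. Qed.

Lemma der_tr_const n (Z W : 'M_n) : der_const Z -> der_tr Z W = f (\tr (Z *m W)).
Proof.
move=> hZ; rewrite /mxtrace der_sum; apply: eq_bigr => i _.
rewrite mxE der_sum; apply: eq_bigr => j _.
by rewrite derf.2 hZ scaler0 addr0.
Qed.

Lemma der_tr_scale_const n (Z P : 'M_n) c :
  der_const P -> der_tr Z (c *: P) = \tr (Z *m P) *: f c.
Proof.
move=> hP; rewrite /mxtrace scaler_suml; apply: eq_bigr => i _.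
rewrite mxE scaler_suml; apply: eq_bigr => j _.
by rewrite mxE derf.2 hP scaler0 add0r scalerA.
Qed.

End DerivationTrace.

(** * The vanishing of the symbol [alpha, N) *)

Section Triviality.
Context (F : fieldType) (p : nat) (charFp : p \in [pchar F]).

Definition H_trivial n (w : Omega F n) := exists u, mod_exact w = wp charFp u.

Lemma H_trivial0 n : H_trivial (0 : Omega F n).
Proof. by exists 0; rewrite !raddf0. Qed.

Lemma H_trivialD n (w w' : Omega F n) : H_trivial w -> H_trivial w' -> H_trivial (w + w').
Proof. by case=> u hu [u' hu']; exists (u + u'); rewrite !raddfD /= hu hu'. Qed.

Lemma H_trivialN n (w : Omega F n) : H_trivial w -> H_trivial (- w).
Proof. by case=> u hu; exists (- u); rewrite !raddfN /= hu. Qed.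

Lemma H_trivialMn n (w : Omega F n) k : H_trivial w -> H_trivial (w *+ k).
Proof.
move=> hw; elim: k => [|k IH]; first exact: H_trivial0.
by rewrite mulrS; apply: H_trivialD.
Qed.

Lemma H_trivial_exact n (w : Omega F n) : H_trivial (d w).
Proof.
exists 0; rewrite raddf0 -[0](raddf0 (@mod_exact F n.+1)).
by apply/mod_exact_eq; rewrite subr0 unfold_in; apply/asboolP; exists w.
Qed.

End Triviality.

Section NormSymbol.
Context (F : fieldType) (q : nat) (charFp : q.+1 \in [pchar F]) (alpha : F).
Local Notation p := q.+1.
Local Notation X := (AS_matrix q alpha).

Let dF (a : F) : Omega F 1 := dwedge 1 [:: a].

Let derF : derivation dF.
Proof. exact: (@dwedge_multider F 1 [::] [::]). Qed.

Lemma dwedge1_expp a : dF (a ^+ p) = 0.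
Proof. by rewrite (derX _ _ derF) (pcharf0 charFp) mul0r scale0r. Qed.

(** Tr (g(S) d(h(S))), where d acts on the coefficients of h. *)
Definition trace_form (g h : {poly F}) : Omega F 1 :=
  der_tr dF (horner_mx X g) (horner_mx X h).

Let const_X : der_const dF X.
Proof.
by move=> i j; have [c ->] := AS_matrix_Frobenius charFp alpha i j; apply: dwedge1_expp.
Qed.

Lemma trace_form_monomial g c k :
  trace_form g (c *: 'X^k) = \tr (horner_mx X (g * 'X^k)) *: dF c.
Proof.
have hX : der_const dF (horner_mx X 'X^k).
  by rewrite rmorphXn /= horner_mx_X; apply: der_constX.
by rewrite /trace_form linearZ /= der_tr_scale_const // rmorphM.
Qed.

Lemma const_horner_expp z : der_const dF (horner_mx X (z ^+ p)).
Proof.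
have charPp : p \in [pchar {poly F}] by rewrite pchar_poly.
elim/poly_ind: z => [|z c IH].
  by rewrite expr0n rmorph0 => i j; rewrite mxE (der0 derF).
rewrite -(pFrobenius_autE charPp) pFrobenius_autD_comm; last exact: mulrC.
rewrite !pFrobenius_autE exprMn -polyC_exp rmorphD rmorphM /= horner_mx_C.
apply: der_constD => //; last exact/der_const_scalar/dwedge1_expp.
by apply: der_constM => //; rewrite rmorphXn /= horner_mx_X; apply: der_constX.
Qed.

(** The trace commutes with the inverse Cartier operator, whose value on z dh is
    z^p h^(p-1) dh.  Both sides are additive in h up to exact forms, the right-hand
    one because the trace of z^p d(carry_sum) is the differential of the trace of
    z^p carry_sum.  On a monomial c S^k the claim is tr (A^p) = (tr A)^p. *)
Lemma inv_cartier_trace_form z h :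
  inv_cartier charFp (trace_form z h) = mod_exact (trace_form (z ^+ p * h ^+ q) h).
Proof.
pose P h :=
  inv_cartier charFp (trace_form z h) = mod_exact (trace_form (z ^+ p * h ^+ q) h).
rewrite -/(P h); have PD h1 h2 : P h1 -> P h2 -> P (h1 + h2).
  rewrite /P => e1 e2.
  have EDl g g' x : trace_form (g + g') x = trace_form g x + trace_form g' x.
    by rewrite /trace_form rmorphD der_trDl.
  have EDr g x y : trace_form g (x + y) = trace_form g x + trace_form g y.
    by rewrite /trace_form rmorphD der_trDr.
  have EM g x y : trace_form g (x * y) = trace_form (g * y) x + trace_form (g * x) y.
    by rewrite /trace_form !rmorphM (der_trM derF) /= [_ g * _ y]comm_horner_mx2.
  have carry := leibniz_carry (pcharf_prime charFp) EDl EDr EM (z ^+ p) h1 h2.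
  rewrite EDr raddfD /= e1 e2 -raddfD; apply/mod_exact_eq.
  rewrite -rpredN opprB -/(trace_form _ _) [X in _ - X]addrC opprD addrA addrAC -carry.
  rewrite /trace_form der_tr_const //; last exact: const_horner_expp.
  rewrite unfold_in; apply/asboolP; eexists (_ *: dwedge 0 [::]).
  by rewrite d_dwedge.
have P0 : P 0.
  rewrite /P /trace_form rmorph0.
  have tr0 g : der_tr dF g 0 = 0.
    rewrite /der_tr big1 // => i _; rewrite big1 // => j _.
    by rewrite mxE (der0 derF) scaler0.
  by rewrite !tr0 !raddf0.
rewrite -[h]coefK poly_def; elim/big_ind: _ => // i _.
rewrite /P !trace_form_monomial inv_cartierE //= big_seq1 -scalerA scalerA.
rewrite -(mxtrace_Frobenius charFp) -rmorphXn /= exprMn exprZn -scalerAr -scalerAl.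
rewrite linearZ mxtraceZ mulrC; congr (mod_exact ((_ * \tr (horner_mx X _)) *: _)).
by rewrite -mulrA -exprSr.
Qed.

Lemma horner_mx_comp (h s : {poly F}) :
  horner_mx (horner_mx X h) s = horner_mx X (s \Po h).
Proof.
elim/poly_ind: s => [|s c IH]; first by rewrite comp_poly0 !rmorph0.
rewrite comp_polyD comp_polyM comp_polyX comp_polyC !rmorphD !rmorphM /= IH.
by rewrite horner_mx_X !horner_mx_C.
Qed.

(** Cayley-Hamilton: the inverse of h(S) is a polynomial in h(S). *)
Lemma horner_mx_inverse h : \det (horner_mx X h) != 0 ->
  exists g, horner_mx X g *m horner_mx X h = 1%:M.
Proof.
set Y := horner_mx X h => detY.
have factorX (f : {poly F}) : exists s, f = s * 'X + (f`_0)%:P.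
  elim/poly_ind: f => [|f c _]; first by exists 0; rewrite mul0r coef0 addr0.
  by exists f; rewrite coefD coefMX coefC add0r.
have [s hs] := factorX (char_poly Y).
have := Cayley_Hamilton Y; rewrite hs rmorphD rmorphM /= horner_mx_X horner_mx_C.
rewrite horner_mx_comp char_poly_det; set c := _ * \det Y => sY.
have c0 : c != 0 by rewrite mulf_neq0 // signr_eq0.
exists (- c^-1 *: (s \Po h)); rewrite linearZ /= -scalemxAl.
have -> : horner_mx X (s \Po h) *m horner_mx X h = - c%:M.
  by apply/eqP; rewrite -addr_eq0; apply/eqP.
by rewrite scalerN scaleNr opprK -scalemx1 scalerA mulVf // scale1r.
Qed.

(** With t = S - alpha, that is t = T, one has alpha = t^p - t; and if g(S) is the
    inverse of h(S) then (t g)^p h^(p-1) = t^p g at S.  So alpha dlog N is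
    wp (Tr (t g dh)). *)
Lemma norm_dlog_trivial (x : AS_alg p alpha) : AS_norm x != 0 ->
  H_trivial charFp ((alpha * (AS_norm x)^-1) *: dF (AS_norm x)).
Proof.
have [h ->] := AS_eval_surj x; rewrite AS_normE // => detY.
have [g gh] := horner_mx_inverse detY.
set Y := horner_mx X h in detY gh *; set G := horner_mx X g in gh.
have hY : (\det Y)^-1 *: dF (\det Y) = der_tr dF G Y.
  rewrite (der_det derF); have -> : \adj Y = \det Y *: G.
    have YG : Y *m G = 1%:M by apply: mulmx1C.
    by rewrite -[LHS]mulmx1 -YG mulmxA mul_adj_mx mul_scalar_mx.
  by rewrite der_trZl scalerA mulVf // scale1r.
rewrite -scalerA hY; pose t : {poly F} := 'X - alpha%:P.
exists (trace_form (t * g) h); rewrite /wp inv_cartier_trace_form -raddfB /=.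
congr (mod_exact _); apply/eqP; rewrite eq_sym subr_eq; apply/eqP.
have charMp : p \in [pchar 'M[F]_p] by apply: pchar_mx.
have Ht : horner_mx X t = X - alpha%:M by rewrite rmorphB /= horner_mx_X horner_mx_C.
have Htp : horner_mx X t ^+ p = X.
  rewrite Ht -(pFrobenius_autE charMp) pFrobenius_autB_comm; last exact: comm_mx_scalar.
  by rewrite !pFrobenius_autE (AS_matrixX charFp) -rmorphXn /= addrK.
rewrite -der_trZl -der_trDl /trace_form -/Y; congr (der_tr dF _ Y).
rewrite !rmorphM !rmorphXn rmorphM /= -/G -/Y Ht.
have -> : ((X - alpha%:M) * G) ^+ p * Y ^+ q = X * G.
  rewrite exprMn_comm; last by rewrite -Ht; apply: comm_horner_mx2.
  rewrite -{1}Ht Htp -mulrA; congr (_ * _).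
  rewrite exprS -mulrA -exprMn_comm; last exact: comm_horner_mx2.
  by rewrite [G * Y]gh expr1n mulr1.
by rewrite mulrBl addrC [alpha%:M * G]mul_scalar_mx subrK.
Qed.

End NormSymbol.

(** * Left multiplication by dlog c *)

Section LogarithmicWedge.
Context (F : fieldType).
Let derD : derivation (@D F) := D_derivation F.

Lemma lwedge_anticomm n (u v : Omega1 F) (w : Omega F n) :
  lwedge u (lwedge v w) = - lwedge v (lwedge u w).
Proof.
elim/ext_power_ind: w => [|a t w IH]; first by rewrite !linear0.
rewrite !linearP /= IH; congr (_ *: _ + _).
rewrite -wedgesE !lwedgeE ?size_tuple //= ?size_tuple //.
have := @alternate_swap _ _ _ n.+2 _ (@wedges_multilinear _ (Omega1 F) n.+2)
  (@wedges_alternating _ _ _) [::] [::] t u v.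
by rewrite /= size_tuple; apply.
Qed.

Lemma lwedge_idem n (u : Omega1 F) (w : Omega F n) : lwedge u (lwedge u w) = 0.
Proof.
elim/ext_power_ind: w => [|a t w IH]; first by rewrite !linear0.
rewrite !linearP /= IH -wedgesE !lwedgeE ?size_tuple //= ?size_tuple //.
by rewrite wedges_alternating ?scaler0 ?addr0 //= ?size_tuple // mem_head.
Qed.

Lemma lwedge_dwedge n (c : F) s : size s = n ->
  lwedge (D c) (dwedge n s) = dwedge n.+1 (c :: s).
Proof. by move=> hs; rewrite /dwedge lwedgeE ?size_map. Qed.

Lemma d_lwedge n c (w : Omega F n) : d (lwedge (D c) w) = - lwedge (D c) (d w).
Proof.
elim/Omega_ind: w => [|a s w hs IH].
  by rewrite linear0 !raddf0.
rewrite linearP !raddfD /= IH; congr (_ + _).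
rewrite lwedge_dwedge // !d_dwedge /= ?hs // -(lwedge_dwedge a) /= ?hs //.
by rewrite -(lwedge_dwedge c) // lwedge_anticomm -!lwedge_dwedge /= ?hs.
Qed.

Definition log_wedge n (c : F) (w : Omega F n) : Omega F n.+1 := c^-1 *: lwedge (D c) w.

Lemma log_wedge_is_linear n c : linear (@log_wedge n c).
Proof.
by move=> a u v; rewrite /log_wedge lwedge_is_linear scalerDr !scalerA mulrC.
Qed.
HB.instance Definition _ n c := GRing.isSemilinear.Build F (Omega F n) (Omega F n.+1)
  *:%R (@log_wedge n c) (GRing.semilinear_linear (@log_wedge_is_linear n c)).

Lemma log_wedgeM n a b (w : Omega F n) : a != 0 -> b != 0 ->
  log_wedge (a * b) w = log_wedge a w + log_wedge b w.
Proof.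
move=> a0 b0; rewrite /log_wedge derD.2 lwedgeD !lwedgeZ scalerDr !scalerA addrC.
by congr (_ *: _ + _ *: _); field; rewrite ?a0 ?b0.
Qed.

Lemma log_wedgeN n a (w : Omega F n) : log_wedge (- a) w = log_wedge a w.
Proof.
by rewrite /log_wedge (derN derD) -[- D a]scaleN1r lwedgeZ invrN scalerA mulrN1 opprK.
Qed.

Lemma log_wedge_anticomm n a b (w : Omega F n) :
  log_wedge a (log_wedge b w) = - log_wedge b (log_wedge a w).
Proof.
by rewrite /log_wedge !linearZ /= lwedge_anticomm !scalerA mulrC !scalerN.
Qed.

Lemma log_wedge_idem n a (w : Omega F n) : log_wedge a (log_wedge a w) = 0.
Proof. by rewrite /log_wedge linearZ /= lwedge_idem !scaler0. Qed.

(** With e = a + b, this expands dlog (a/e) /\ dlog (b/e) = 0. *)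
Lemma log_wedge_steinberg n a b (w : Omega F n) : a != 0 -> b != 0 -> a + b != 0 ->
  log_wedge a (log_wedge b w) =
  log_wedge a (log_wedge (a + b) w) - log_wedge b (log_wedge (a + b) w).
Proof.
move=> a0 b0 ab0; rewrite /log_wedge !linearZ /= derD.1 !lwedgeD !linearD /=.
rewrite !lwedge_idem oppr0 !scaler0 add0r addr0.
rewrite [lwedge (D b) (lwedge (D a) w)]lwedge_anticomm opprK !scalerA -scalerDl.
congr (_ *: _).
by field; rewrite ab0 b0 a0.
Qed.

Lemma log_wedge_dwedge n c a s : size s = n ->
  log_wedge c (a *: dwedge n s) = (c^-1 * a) *: dwedge n.+1 (c :: s).
Proof.
by move=> hs; rewrite linearZ /= /log_wedge lwedge_dwedge // scalerA mulrC.
Qed.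

Lemma log_wedge_exact n c (w : Omega F n) :
  w \in @exact_form F n -> log_wedge c w \in @exact_form F n.+1.
Proof.
case: n w => [|n] w.
  rewrite unfold_in => /eqP ->; rewrite linear0 unfold_in; apply/asboolP.
  by exists 0; rewrite raddf0.
rewrite !unfold_in => /asboolP[e ->]; apply/asboolP; exists (- log_wedge c e).
have [->|c0] := eqVneq c 0.
  by rewrite /log_wedge invr0 !scale0r oppr0 raddf0.
have DV : D c^-1 = - c^-2 *: D c.
  have := derD.2 c c^-1; rewrite mulfV // (der1 derD) => /eqP; rewrite eq_sym addr_eq0.
  move=> /eqP /(congr1 (fun u => c^-1 *: u)).
  rewrite scalerN !scalerA mulVf // scale1r => ->.
  by rewrite scaleNr -invfM expr2.
rewrite raddfN /= /log_wedge dZ d_lwedge DV lwedgeZ lwedge_idem scaler0 addr0.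
by rewrite scalerN opprK.
Qed.

(** dlog c is fixed by the inverse Cartier operator and closed, so multiplying by it
    commutes with wp and preserves exact forms. *)
Lemma log_wedge_trivial p (charFp : p \in [pchar F]) n c (w : Omega F n) :
  H_trivial charFp w -> H_trivial charFp (log_wedge c w).
Proof.
case=> u wu.
have [v [uv cuv]] : exists v, inv_cartier charFp u = mod_exact v /\
    inv_cartier charFp (log_wedge c u) = mod_exact (log_wedge c v).
  elim/Omega_ind: u {wu} => [|a s u hs [v [uv cuv]]].
    by exists 0; rewrite !linear0 !raddf0.
  exists ((a ^+ p * \prod_(b <- s) b ^+ p.-1) *: dwedge n s + v).
  rewrite raddfD /= inv_cartierE // uv -raddfD; split=> //.
  rewrite !linearD raddfD /= cuv !log_wedge_dwedge // inv_cartierE /= ?hs //.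
  rewrite big_cons -raddfD; congr (mod_exact (_ *: _ + _)).
  have [->|c0] := eqVneq c 0.
    rewrite invr0 !mul0r expr0n -[p]prednK ?prime_gt0 ?(pcharf_prime charFp) //=.
    by rewrite mul0r.
  have pE : p = p.-1.+1 by rewrite prednK // prime_gt0 // (pcharf_prime charFp).
  rewrite exprMn {1}pE exprS exprVn; field.
  by rewrite c0 expf_neq0.
have e : w - (v - u) \in @exact_form F n.
  by apply/mod_exact_eq; rewrite wu /wp uv raddfB.
exists (log_wedge c u); rewrite /wp cuv -raddfB; apply/mod_exact_eq.
by rewrite -!linearB; apply: log_wedge_exact.
Qed.

End LogarithmicWedge.

(** * Symbols and Albert forms *)

Section Symbols.
Context (F : fieldType) (p : nat) (charFp : p \in [pchar F]).
Local Notation trivial := (H_trivial charFp).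

Definition AS_symbol (alpha a : F) : Omega F 1 := log_wedge a (alpha *: dwedge 0 [::]).

Lemma AS_symbolE alpha a : AS_symbol alpha a = (alpha * a^-1) *: dwedge 1 [:: a].
Proof. by rewrite /AS_symbol log_wedge_dwedge // mulrC. Qed.

Lemma AS_symbolD alpha beta a :
  AS_symbol (alpha + beta) a = AS_symbol alpha a + AS_symbol beta a.
Proof. by rewrite /AS_symbol scalerDl linearD. Qed.

Lemma AS_symbolM alpha a b : a != 0 -> b != 0 ->
  AS_symbol alpha (a * b) = AS_symbol alpha a + AS_symbol alpha b.
Proof. exact: log_wedgeM. Qed.

Lemma log_wedge_AS_symbol alpha a b :
  log_wedge a (AS_symbol alpha b) = - log_wedge b (AS_symbol alpha a).
Proof. exact: log_wedge_anticomm. Qed.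

Lemma AS_symbol_self a : trivial (AS_symbol a a).
Proof.
have [->|a0] := eqVneq a 0.
  by rewrite /AS_symbol scale0r linear0; apply: H_trivial0.
rewrite AS_symbolE mulfV // scale1r -[dwedge 1 _](d_dwedge (n := 0)) //.
exact: H_trivial_exact.
Qed.

Lemma AS_symbol_wp b a : trivial (AS_symbol (b ^+ p - b) a).
Proof.
have [->|a0] := eqVneq a 0.
  by rewrite /AS_symbol /log_wedge invr0 scale0r; apply: H_trivial0.
exists (dlog 1 b [:: a]); rewrite (wp_dlog charFp) //; last by rewrite inE eq_sym.
by rewrite AS_symbolE /dlog big_seq1.
Qed.

Lemma AS_symbol_norm (alpha : F) (x : AS_alg p alpha) :
  AS_norm x != 0 -> trivial (AS_symbol alpha (AS_norm x)).
Proof.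
case: p charFp x => [|q] hp x x0; last by rewrite AS_symbolE; apply: norm_dlog_trivial.
by have := pcharf_prime hp.
Qed.

Lemma AS_norm_kernel (alpha : F) (x : AS_alg p alpha) :
  x != 0 -> AS_norm x = 0 -> exists b, alpha = b ^+ p - b.
Proof.
case: p charFp x => [|q] hp x; last exact: AS_norm_eq0.
by have := pcharf_prime hp.
Qed.

(** The multiplier k absorbs the factor 2 in [2 alpha, a) = 2 [alpha, a). *)
Definition AS_slot (alpha : F) (theta : Omega F 1) :=
  exists a k, trivial (theta - AS_symbol alpha a *+ k).

Lemma AS_slot_norm (alpha : F) theta (x : AS_alg p alpha) :
  AS_slot alpha theta -> AS_norm x != 0 -> trivial (log_wedge (AS_norm x) theta).
Proof.
case=> a [k hk] x0; rewrite -[theta](subrK (AS_symbol alpha a *+ k)) linearD.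
apply: H_trivialD; first exact: log_wedge_trivial.
rewrite linearMn /= log_wedge_AS_symbol; apply/H_trivialMn/H_trivialN/log_wedge_trivial.
exact: AS_symbol_norm.
Qed.

Lemma AS_slot_kernel (alpha : F) theta (x : AS_alg p alpha) :
  AS_slot alpha theta -> x != 0 -> AS_norm x = 0 -> trivial theta.
Proof.
case=> a [k hk] x0 /(AS_norm_kernel x0) [b alphaE].
rewrite -[theta](subrK (AS_symbol alpha a *+ k)); apply: H_trivialD => //.
by apply: H_trivialMn; rewrite alphaE; apply: AS_symbol_wp.
Qed.

(** Multiplicativity and anticommutativity: b and c may be changed by factors whose
    logarithmic differentials annihilate the class of w. *)
Lemma log_wedge2_mod_norms n (w : Omega F n) b c u v :
  b != 0 -> c != 0 -> u != 0 -> v != 0 ->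
  trivial (log_wedge u w) -> trivial (log_wedge v w) ->
  trivial (log_wedge (c * v) (log_wedge (b * u) w)) ->
  trivial (log_wedge c (log_wedge b w)).
Proof.
move=> b0 c0 u0 v0 hu hv h.
have -> : log_wedge c (log_wedge b w) = log_wedge (c * v) (log_wedge (b * u) w)
   - log_wedge c (log_wedge u w) + log_wedge (b * u) (log_wedge v w).
  rewrite (log_wedgeM _ c0 v0) [log_wedge v _]log_wedge_anticomm addrAC subrK.
  by rewrite (log_wedgeM _ b0 u0) linearD /= addrK.
apply: H_trivialD; last exact: log_wedge_trivial.
by apply: H_trivialD => //; apply/H_trivialN/log_wedge_trivial.
Qed.

(** If theta is nontrivial, then all three norm forms are anisotropic.  A zero of the
    Albert form then gives, up to sign, a norm A = b N(y) + c N(z); dlog of each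
    norm annihilates the class of theta, and the Steinberg relation for b N(y) and
    c N(z) leaves only terms containing dlog A. *)
Lemma albert_symbol_trivial alpha beta b c theta :
  AS_slot alpha theta -> AS_slot beta theta -> AS_slot (alpha + beta) theta ->
  b != 0 -> c != 0 ->
  (exists v : AS_alg p (alpha + beta) * AS_alg p alpha * AS_alg p beta,
         v != 0 /\ albert_form alpha beta b c v = 0) ->
  trivial (log_wedge c (log_wedge b theta)).
Proof.
move=> sa sb sab b0 c0 [[[x y] z] [v0]]; rewrite /albert_form /= => zero.
have [theta0|nz] := EM (trivial theta).
  by do 2!apply: log_wedge_trivial.
have ker gamma (t : AS_alg p gamma) : AS_slot gamma theta -> AS_norm t = 0 -> t = 0.
  by move=> st Nt; apply: contrapT => /eqP t0; apply/nz/(AS_slot_kernel st t0).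
have [z0|z0] := eqVneq (AS_norm z) 0.
  have y0 : AS_norm y != 0.
    apply: contraNneq v0 => y0; move: zero; rewrite y0 z0 !mulr0 !addr0 => x0.
    by rewrite (ker _ _ sab x0) (ker _ _ sa y0) (ker _ _ sb z0).
  move: zero; rewrite z0 mulr0 addr0 => /eqP; rewrite addr_eq0 => /eqP xE.
  have x0 : AS_norm x != 0 by rewrite xE oppr_eq0 mulf_neq0.
  have := AS_slot_norm sab x0; rewrite xE log_wedgeN log_wedgeM // => h.
  apply: log_wedge_trivial; rewrite -[log_wedge b _](addrK (log_wedge (AS_norm y) theta)).
  by apply/(H_trivialD h)/H_trivialN/AS_slot_norm.
have [y0|y0] := eqVneq (AS_norm y) 0.
  move: zero; rewrite y0 mulr0 addr0 => /eqP; rewrite addr_eq0 => /eqP xE.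
  have x0 : AS_norm x != 0 by rewrite xE oppr_eq0 mulf_neq0.
  have := AS_slot_norm sab x0; rewrite xE log_wedgeN log_wedgeM // => h.
  rewrite log_wedge_anticomm; apply/H_trivialN/log_wedge_trivial.
  rewrite -[log_wedge c _](addrK (log_wedge (AS_norm z) theta)).
  by apply/(H_trivialD h)/H_trivialN/AS_slot_norm.
apply: (log_wedge2_mod_norms b0 c0 y0 z0); [exact: AS_slot_norm | exact: AS_slot_norm|].
have xE : c * AS_norm z + b * AS_norm y = - AS_norm x.
  by apply/eqP; rewrite -addr_eq0 addrC addrA addrAC zero.
have [x0|x0] := eqVneq (AS_norm x) 0.
  have -> : b * AS_norm y = - (c * AS_norm z).
    by apply/eqP; rewrite -addr_eq0 addrC xE x0 oppr0.
  by rewrite log_wedgeN log_wedge_idem; apply: H_trivial0.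
rewrite log_wedge_steinberg ?mulf_neq0 //; last by rewrite xE oppr_eq0.
rewrite xE !log_wedgeN; apply: H_trivialD; last apply: H_trivialN.
  by apply/log_wedge_trivial/AS_slot_norm.
by apply/log_wedge_trivial/AS_slot_norm.
Qed.

(** [alpha + B, B) = [alpha, B) + [B, B) = [alpha, a) + [alpha, n) for B = a n. *)
Lemma AS_slot_shift alpha a n : a != 0 ->
  trivial (AS_symbol alpha n) -> AS_slot (alpha + a * n) (AS_symbol alpha a).
Proof.
move=> a0 hn; have [->|n0] := eqVneq n 0.
  by exists a, 1%N; rewrite mulr0 addr0 subrr; apply: H_trivial0.
exists (a * n), 1%N.
rewrite mulr1n AS_symbolD AS_symbolM // -addrA opprD addNKr.
by apply/H_trivialN/H_trivialD => //; apply: AS_symbol_self.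
Qed.

End Symbols.

(** * Triviality of all 3-forms *)

Section Conclusion.
Context (F : fieldType) (p : nat) (charFp : p \in [pchar F]).
Local Notation trivial := (H_trivial charFp).
Context (Albert_isotropic : forall alpha beta gamma delta : F,
  gamma != 0 -> delta != 0 ->
  exists v : AS_alg p (alpha + beta) * AS_alg p alpha * AS_alg p beta,
    v != 0 /\ albert_form alpha beta gamma delta v = 0).

Lemma symbol3_trivial_odd alpha a b c : p != 2 -> b != 0 -> c != 0 ->
  trivial (log_wedge c (log_wedge b (AS_symbol alpha a))).
Proof.
move=> p2 b0 c0; have pr_p := pcharf_prime charFp.
have sa : AS_slot charFp alpha (AS_symbol alpha a).
  by exists a, 1%N; rewrite mulr1n subrr; apply: H_trivial0.
apply: (albert_symbol_trivial (alpha := alpha) (beta := alpha)) => //;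
  last exact: Albert_isotropic.
(* (p + 1) / 2 is the inverse of 2 modulo p. *)
exists a, p.+1./2; rewrite AS_symbolD -mulr2n -mulrnA mul2n halfK /=.
have -> : odd p by case: (even_prime pr_p) p2 => // ->.
rewrite /= subn0 mulrS -[_ *+ p]scaler_nat (pcharf0 charFp) scale0r addr0 subrr.
exact: H_trivial0.
Qed.

(** 1 + y + alpha y^2 is the norm of 1 + y T.  Up to the square y^2 it equals
    s = alpha + r^2 - r with r = 1/y, and [alpha, s) = [s, s) - [r^2 - r, s). *)
Lemma AS_symbol_shifted_norm2 alpha y : p = 2 -> y != 0 ->
  trivial (AS_symbol alpha (1 + y + alpha * y ^+ 2)).
Proof.
move=> p2 y0; have two0 : 2%:R = 0 :> F by rewrite -(pcharf0 charFp) p2.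
pose r := y^-1; pose s := alpha + (r ^+ p - r).
have -> : 1 + y + alpha * y ^+ 2 = s * y * y.
  have -> : s * y * y = 1 + y + alpha * y ^+ 2 - 2%:R * y by rewrite /s /r p2; field.
  by rewrite two0 mul0r subr0.
have [->|s0] := eqVneq s 0.
  by rewrite !mul0r /AS_symbol /log_wedge invr0 scale0r; apply: H_trivial0.
rewrite !AS_symbolM ?mulf_neq0 // -addrA -mulr2n -scaler_nat two0 scale0r addr0.
have -> : alpha = s - (r ^+ p - r) by rewrite addrK.
rewrite /AS_symbol scalerBl linearB /=.
by apply: H_trivialD; [apply: AS_symbol_self | apply/H_trivialN/AS_symbol_wp].
Qed.

(** The parameters are alpha + a n_1 and alpha + a n_2, with n_1 = alpha y^2 and
    n_2 = 1 + y + alpha y^2 the norms of y T and 1 + y T.  In characteristic 2 the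
    sum n_1 + n_2 is 1 + y, so y = 1 + alpha/a makes the two parameters sum to alpha. *)
Lemma symbol3_trivial_even alpha a b c : p = 2 -> a != 0 -> b != 0 -> c != 0 ->
  trivial (log_wedge c (log_wedge b (AS_symbol alpha a))).
Proof.
move=> p2 a0 b0 c0; have two0 : 2%:R = 0 :> F by rewrite -(pcharf0 charFp) p2.
pose y := 1 + alpha / a.
have [y0|y0] := eqVneq y 0.
  have -> : alpha = a.
    have -> : alpha = a * y - 2%:R * a + a by rewrite /y; field.
    by rewrite y0 two0 mulr0 mul0r subr0 add0r.
  by do 2!apply: log_wedge_trivial; apply: AS_symbol_self.
have [->|alpha0] := eqVneq alpha 0.
  by rewrite /AS_symbol scale0r !linear0; apply: H_trivial0.
apply: (albert_symbol_trivial (alpha := alpha + a * (alpha * y ^+ 2))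
  (beta := alpha + a * (1 + y + alpha * y ^+ 2))) => //; last exact: Albert_isotropic.
- apply: AS_slot_shift => //; rewrite expr2 !AS_symbolM ?mulf_neq0 //.
  rewrite -mulr2n -scaler_nat two0 scale0r addr0; exact: AS_symbol_self.
- by apply: AS_slot_shift => //; apply: AS_symbol_shifted_norm2.
set tau := _ + _; have -> : tau = alpha.
  have -> : tau = alpha + 2%:R * (alpha + a + a * alpha * y ^+ 2).
    by rewrite /tau /y; field.
  by rewrite two0 mul0r addr0.
by exists a, 1%N; rewrite mulr1n subrr; apply: H_trivial0.
Qed.

Lemma Omega3_trivial (w : Omega F 3) : trivial w.
Proof.
elim/Omega_ind: w => [|e s w hs hw]; first exact: H_trivial0.
apply: H_trivialD => //; have [s0|s0] := boolP (0 \in s).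
  move: hs; case/splitPr: s0 => s1 s2 hs.
  rewrite (der0 (@dwedge_multider F 3 s1 s2 _)); last by rewrite -hs !size_cat addnS.
  by rewrite scaler0; apply: H_trivial0.
case: s hs s0 => [|c [|b [|a []]]] // _; rewrite !inE !negb_or ![0 == _]eq_sym.
case/and3P=> c0 b0 a0.
have -> : e *: dwedge 3 [:: c; b; a] =
    log_wedge c (log_wedge b (AS_symbol (e * (a * b * c)) a)).
  rewrite AS_symbolE !log_wedge_dwedge //; congr (_ *: _).
  by field; rewrite a0 b0 c0.
have [p2|p2] := eqVneq p 2; first exact: symbol3_trivial_even.
exact: symbol3_trivial_odd.
Qed.

End Conclusion.

Theorem theorem4p3 (p : nat) (F : fieldType) (charFp : p \in [pchar F])
    (Albert_isotropic : forall alpha beta gamma delta : F,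
       gamma != 0 -> delta != 0 ->
       exists v : AS_alg p (alpha + beta) * AS_alg p alpha * AS_alg p beta,
         v != 0 /\ albert_form alpha beta gamma delta v = 0) :
  forall h : H_succ charFp 3, h = 0.
Proof.
move=> h; rewrite -[h]reprK; have [w ->] := mod_exact_surj (repr h).
have [u wu] := Omega3_trivial charFp Albert_isotropic w.
apply/eqP; rewrite -[0](raddf0 \pi_(H_succ charFp 3)) -Quotient.idealrBE subr0 unfold_in.
by apply/asboolP; exists u.
Qed.
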